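(* For every integer $m\ge 1$, $$\left|ASM^{\circ}_{2m,1}\right|=\left(\prod_{k=0}^{m-1}\frac{(3k+1)!}{(m+k)!}\right)^{3}\ \prod_{i=1}^{m}\left(\frac{3i-1}{3i-2}\prod_{j=i}^{m}\frac{m+i+j-1}{2i+j-1}\right).$$
   Context: For $n,k\ge1$, $ASM^{\circ}_{n,k}$ (chained circular alternating sign matrices) is the set of $k$-tuples $(A^{(1)},\dots,A^{(k)})$ of $n\times n$ matrices with entries in $\{-1,0,1\}$ satisfying: (1) $\sum_{j=1}^r A^{(\ell)}_{i,j}\in\{0,1\}$ for all $1\le i\le n$, $1\le r\le n$, $1\le\ell\le k$; (2) $\sum_{j=1}^n A^{(\ell-1)}_{i,j}+\sum_{j=1}^r A^{(\ell)}_{n+1-j,i}\in\{0,1\}$ for all $1\le i\le n$, $1\le r\le n$, $1\le\ell\le k$, where $A^{(0)}=A^{(k)}$; (3) the sum of all entries $\sum_{i,j,\ell}A^{(\ell)}_{i,j}$ is maximum among all such $k$-tuples satisfying (1) and (2). *)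

(* Defs.v *)
From mathcomp Require Import all_boot all_order all_algebra.

Set Implicit Arguments.
Unset Strict Implicit.
Unset Printing Implicit Defensive.

Import Order.TTheory GRing.Theory Num.Theory.
Local Open Scope ring_scope.

Definition asm_entry : finType := seq_sub [:: -1; 0; 1 : int].

(* All indices are 0-based: A^(l)_{i,j} with 1 <= l <= k and 1 <= i, j <= n
   is [ent A l i j] with l : 'I_k and i, j : 'I_n shifted down by one. *)
Definition ent n k (A : k.-tuple 'M[asm_entry]_n) (l : 'I_k) (i j : 'I_n)
  : int := ssval (tnth A l i j).

(* The partial sum over the first r columns, 1 <= r <= n, is indexed by the last
   column in it, r : 'I_n, hence the guard [j <= r]. *)
Definition row_condition n k (A : k.-tuple 'M[asm_entry]_n) : bool :=
  [forall l : 'I_k, forall i : 'I_n, forall r : 'I_n,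
    (\sum_(j < n | (j <= r)%N) ent A l i j) \in [:: 0; 1]].

(* [ord_pred] is the cyclic predecessor, so that A^(0) = A^(k);
   [rev_ord j] is the row n + 1 - j, i.e. columns are read from the bottom. *)
Definition chain_condition n k (A : k.-tuple 'M[asm_entry]_n) : bool :=
  [forall l : 'I_k, forall i : 'I_n, forall r : 'I_n,
    (\sum_(j < n) ent A (ord_pred l) i j
      + \sum_(j < n | (j <= r)%N) ent A l (rev_ord j) i) \in [:: 0; 1]].

Definition total_sum n k (A : k.-tuple 'M[asm_entry]_n) : int :=
  \sum_(l < k) \sum_(i < n) \sum_(j < n) ent A l i j.

Definition cc_admissible n k (A : k.-tuple 'M[asm_entry]_n) : bool :=
  row_condition A && chain_condition A.

(* Chained circular alternating sign matrices; meant for n, k >= 1. *)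
Definition ASMo n k : {set k.-tuple 'M[asm_entry]_n} :=
  [set A | cc_admissible A &
    [forall B : k.-tuple 'M[asm_entry]_n,
      cc_admissible B ==> (total_sum B <= total_sum A)]].

(* Main.v *)
Require Import Defs.
From mathcomp Require Import all_boot all_order all_fingroup all_algebra all_field.
From mathcomp Require Import ring lra zify.

(* For n = 2m the maximality condition forces r_i + c_i = 1 for all i, where r_i
   and c_i are the i-th row and column sums, so that the matrices are the
   configurations of a six-vertex model on n lines: the i-th line runs along
   row i, has its state flipped, and comes back up column i (this is the
   fundamental domain of a quarter-turn symmetric alternating sign matrix of
   order 4m).  Attach a parameter x_i to the i-th line.  At a cube root of unity
   w the Yang-Baxter equation makes the partition function Z symmetric in the
   x_i; the configurations freeze when x_2^2 = w x_1^2, which expresses Z through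
   the function Z of the n - 2 remaining lines; and Z has degree at most 4(n - 1)
   in x_1 and vanishes at x_1 = 0.  Together with their images under symmetry
   these are enough values to determine Z by interpolation.  The function

     (w - 1)^(2m) w^(2m(m-1)) (prod_i x_i) D01^3 D02 / Delta^4

   satisfies the same recursion, where Delta is the Vandermonde determinant in
   the x_i^2 and D01, D02 are the alternants in the x_i^2 whose exponents are the
   first 2m natural numbers congruent to 0, 1 (resp. 0, 2) modulo 3.  At
   x_i = s^i all three alternants become Vandermonde products, and s -> 1 gives
   the product formula. *)

Set Implicit Arguments.
Unset Strict Implicit.
Unset Printing Implicit Defensive.

Import Order.TTheory GRing.Theory Num.Theory.
Local Open Scope ring_scope.

(** * Sums over states and over tuples of states *)

Lemma sum_bool (R : nmodType) (f : bool -> R) : \sum_(b : bool) f b = f true + f false.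
Proof. exact: big_bool. Qed.

Section TupleSums.
Variables (R : nmodType) (T : finType).

Lemma sum_tuple0 (f : seq T -> R) : \sum_(t : 0.-tuple T) f t = f [::].
Proof.
rewrite (big_pred1 [tuple]) // => t.
by apply/esym/eqP; apply: val_inj; rewrite /= tuple0.
Qed.

Lemma sum_tupleS n (f : seq T -> R) :
  \sum_(t : n.+1.-tuple T) f t = \sum_(b : T) \sum_(t : n.-tuple T) f (b :: t).
Proof.
rewrite pair_big /= (reindex (fun p : T * n.-tuple T => [tuple of p.1 :: p.2])) //=.
exists (fun t : n.+1.-tuple T => (thead t, [tuple of behead t])) => /=.
  by move=> [b t] _; congr (_, _); apply: val_inj.
by move=> t _; rewrite [RHS]tuple_eta; apply: val_inj.
Qed.

Lemma sum_tuple_cat m n (f : seq T -> R) :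
  \sum_(t : (m + n).-tuple T) f t
  = \sum_(p : m.-tuple T) \sum_(q : n.-tuple T) f (p ++ q).
Proof.
elim: m f => [|m IHm] f.
  by rewrite (sum_tuple0 (fun s => \sum_(q : n.-tuple T) f (s ++ q))).
rewrite (@sum_tupleS m (fun s => \sum_(q : n.-tuple T) f (s ++ q))) addSn sum_tupleS.
by apply: eq_bigr => b _; rewrite (IHm (fun s => f (b :: s))).
Qed.

Lemma sum_tuple_eqsize m n (f : seq T -> R) : m = n ->
  \sum_(t : m.-tuple T) f t = \sum_(t : n.-tuple T) f t.
Proof. by move->. Qed.

Lemma sum_tuple_mid (S : Type) (l1 l2 : seq S) a b (f : seq T -> R) :
  \sum_(t : (size (l1 ++ a :: b :: l2)).-tuple T) f t
  = \sum_(p : (size l1).-tuple T) \sum_(q : (size l2).-tuple T)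
      \sum_(k1 : T) \sum_(k2 : T) f (p ++ k1 :: k2 :: q).
Proof.
rewrite (sum_tuple_eqsize _ (size_cat _ _)) sum_tuple_cat.
apply: eq_bigr => p _.
rewrite (@sum_tupleS _ (fun s => f (p ++ s))) [RHS]exchange_big.
apply: eq_bigr => k1 _; rewrite [RHS]exchange_big.
by rewrite (@sum_tupleS _ (fun s => f (p ++ k1 :: s))).
Qed.

End TupleSums.

(** * The six-vertex model and the Yang-Baxter equation *)

Section Lattice.
Variables (R : comNzRingType) (T : eqType).
Implicit Types (wt : T -> T -> R * R * R) (rs cs ls : seq T).
Implicit Types (hi ho wi wo : seq bool).

(* Weight of a crossing of a row line (state h to k) with a column line (w to u);
   p = (a, b, c): equal states, distinct states, exchanged states. *)
Definition vtx (p : R * R * R) (h w k u : bool) : R :=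
  if (k == h) && (u == w) then (if h == w then p.1.1 else p.1.2)
  else if (k == w) && (u == h) then p.2 else 0.

(* Rows are read from left to right, with wi the states below the row and wo
   those above it; row labels are listed from top to bottom. *)
Fixpoint row wt (l : T) cs (h : bool) wi wo (k : bool) : R :=
  match cs, wi, wo with
  | [::], [::], [::] => (h == k)%:R
  | c :: cs', p :: wi', q :: wo' =>
      \sum_(u : bool) vtx (wt l c) h p u q * row wt l cs' u wi' wo' k
  | _, _, _ => 0
  end.

Fixpoint grid wt rs cs hi ho wi wo : R :=
  match rs, hi, ho with
  | [::], [::], [::] => (wi == wo)%:R
  | r :: rs', h :: hi', k :: ho' =>
      \sum_(v : (size cs).-tuple bool)
         row wt r cs h v wo k * grid wt rs' cs hi' ho' wi v
  | _, _, _ => 0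
  end.

Definition falses n := nseq n false.

(* The i-th line leaves row i in state h_i and enters column i in state ~~ h_i;
   a matrix entry is +1, -1 at a crossing (0, 1) -> (1, 0), (1, 0) -> (0, 1). *)
Definition qtZ wt ls : R :=
  \sum_(h : (size ls).-tuple bool)
     grid wt ls ls (falses (size ls)) h (map negb h) (falses (size ls)).

(** The Yang-Baxter equation for two row lines with mutual crossing [s] that meet one column line:
    [s] lies to the left of the column on one side and to its right on the other. Below, [col_yb] is
    the analogue for two column lines that meet one row. *)
Definition row_yb (s p1 p2 : R * R * R) := forall h1 h2 w m1 m2 u : bool,
  \sum_(k1 : bool) \sum_(k2 : bool) vtx s h1 h2 k1 k2 *
     (\sum_(v : bool) vtx p2 k2 v m2 u * vtx p1 k1 w m1 v)
  = \sum_(k1 : bool) \sum_(k2 : bool)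
     (\sum_(v : bool) vtx p1 h1 v k1 u * vtx p2 h2 w k2 v) * vtx s k1 k2 m1 m2.

Definition col_yb (s p1 p2 : R * R * R) := forall v1 v2 h m1 m2 k : bool,
  \sum_(k1 : bool) \sum_(k2 : bool) vtx s v1 v2 k1 k2 *
     (\sum_(u : bool) vtx p2 h k2 u m2 * vtx p1 u k1 k m1)
  = \sum_(k1 : bool) \sum_(k2 : bool)
     (\sum_(u : bool) vtx p1 h v1 u k1 * vtx p2 u v2 k k2) * vtx s k1 k2 m1 m2.

Definition row2 wt a b cs h1 h2 wi wo k1 k2 : R :=
  \sum_(v : (size cs).-tuple bool) row wt a cs h1 v wo k1 * row wt b cs h2 wi v k2.

Lemma row2_cons wt a b c cs h1 h2 p wi q wo k1 k2 :
  row2 wt a b (c :: cs) h1 h2 (p :: wi) (q :: wo) k1 k2 =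
  \sum_(m1 : bool) \sum_(m2 : bool)
    (\sum_(u : bool) vtx (wt a c) h1 u m1 q * vtx (wt b c) h2 p m2 u) *
    row2 wt a b cs m1 m2 wi wo k1 k2.
Proof.
rewrite /row2 /= (@sum_tupleS _ _ _ (fun v => row wt a (c :: cs) h1 v (q :: wo) k1 *
   row wt b (c :: cs) h2 (p :: wi) v k2)) /=.
transitivity (\sum_(u : bool) \sum_(m1 : bool) \sum_(m2 : bool)
   (vtx (wt a c) h1 u m1 q * vtx (wt b c) h2 p m2 u) *
   \sum_(t : (size cs).-tuple bool)
     row wt a cs m1 t wo k1 * row wt b cs m2 wi t k2).
  apply: eq_bigr => u _.
  transitivity (\sum_(t : (size cs).-tuple bool) \sum_(m1 : bool) \sum_(m2 : bool)
     (vtx (wt a c) h1 u m1 q * vtx (wt b c) h2 p m2 u) *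
     (row wt a cs m1 t wo k1 * row wt b cs m2 wi t k2)).
    apply: eq_bigr => t _; rewrite mulr_suml; apply: eq_bigr => m1 _.
    rewrite mulr_sumr; apply: eq_bigr => m2 _; ring.
  rewrite exchange_big; apply: eq_bigr => m1 _.
  rewrite exchange_big; apply: eq_bigr => m2 _.
  by rewrite mulr_sumr.
rewrite exchange_big; apply: eq_bigr => m1 _.
rewrite exchange_big; apply: eq_bigr => m2 _.
by rewrite mulr_suml.
Qed.

(** The Yang-Baxter equation carries the crossing [s] past one column at a time, from the left end
    of the two rows to their right end, and this exchanges the rows. *)
Lemma row2_swap wt s a b cs h1 h2 wi wo m1 m2 :
  {in cs, forall c, row_yb s (wt a c) (wt b c)} ->
  \sum_(k1 : bool) \sum_(k2 : bool)
     vtx s h1 h2 k1 k2 * row2 wt b a cs k2 k1 wi wo m2 m1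
  = \sum_(k1 : bool) \sum_(k2 : bool)
     row2 wt a b cs h1 h2 wi wo k1 k2 * vtx s k1 k2 m1 m2.
Proof.
elim: cs h1 h2 wi wo => [|c cs IHcs] h1 h2 [|p wi] [|q wo] yb;
  try by rewrite /row2 big1 ?big1 // => k1 _; rewrite ?big1 // => k2 _;
    (rewrite [\sum_v _]big1 ?mulr0 ?mul0r // => v _; case: (tval v) => [|? ?];
      rewrite /= ?mul0r ?mulr0).
- rewrite /row2 /=.
  under [LHS]eq_bigr do under eq_bigr do
    rewrite (sum_tuple0 (fun v => row wt b [::] _ v [::] m2 * row wt a [::] _ [::] v m1)) /=.
  under [RHS]eq_bigr do under eq_bigr do
    rewrite (sum_tuple0 (fun v => row wt a [::] _ v [::] _ * row wt b [::] _ [::] v _)) /=.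
  rewrite !sum_bool /= ; case: h1; case: h2; case: m1; case: m2;
  by rewrite /= ?(mulr0,mul0r,mulr1,mul1r,addr0,add0r).
have yb' : {in cs, forall c0 : T, row_yb s (wt a c0) (wt b c0)}.
  by move=> c' c'cs; apply: yb; rewrite inE c'cs orbT.
have {}yb : row_yb s (wt a c) (wt b c) by apply: yb; rewrite mem_head.
transitivity (\sum_(n1 : bool) \sum_(n2 : bool)
   (\sum_(k1 : bool) \sum_(k2 : bool) vtx s h1 h2 k1 k2 *
   (\sum_(v : bool) vtx (wt b c) k2 v n2 q * vtx (wt a c) k1 p n1 v)) *
   row2 wt b a cs n2 n1 wi wo m2 m1).
  under [LHS]eq_bigr do under eq_bigr do rewrite row2_cons.
  by rewrite !sum_bool; ring.
transitivity (\sum_(k1 : bool) \sum_(k2 : bool)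
   (\sum_(v : bool) vtx (wt a c) h1 v k1 q * vtx (wt b c) h2 p k2 v) *
   (\sum_(n1 : bool) \sum_(n2 : bool)
     vtx s k1 k2 n1 n2 * row2 wt b a cs n2 n1 wi wo m2 m1)).
  under [LHS]eq_bigr do under eq_bigr do rewrite yb.
  by rewrite !sum_bool; ring.
under [LHS]eq_bigr do under eq_bigr do rewrite (IHcs _ _ _ _ yb').
under [RHS]eq_bigr do under eq_bigr do rewrite row2_cons.
by rewrite !sum_bool; ring.
Qed.

Lemma vtx_falses s k1 k2 :
  vtx s false false k1 k2 = if k1 || k2 then 0 else s.1.1.
Proof. by case: k1; case: k2. Qed.

Lemma vtx_to_falses s k1 k2 :
  vtx s k1 k2 false false = if k1 || k2 then 0 else s.1.1.
Proof. by case: k1; case: k2. Qed.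

(** Both rows start in state false, so at the left border the crossing acts as the scalar [s.1.1];
    it comes out between the right ends of the two rows. *)
Lemma grid_swap_rows wt s l1 a b l2 cs g1 m1 m2 g2 wi wo :
  {in cs, forall c, row_yb s (wt a c) (wt b c)} -> size g1 = size l1 ->
  s.1.1 * grid wt (l1 ++ b :: a :: l2) cs (falses (size (l1 ++ b :: a :: l2)))
     (g1 ++ m2 :: m1 :: g2) wi wo
  = \sum_(k1 : bool) \sum_(k2 : bool)
     grid wt (l1 ++ a :: b :: l2) cs (falses (size (l1 ++ a :: b :: l2)))
       (g1 ++ k1 :: k2 :: g2) wi wo * vtx s k1 k2 m1 m2.
Proof.
move=> yb; elim: l1 g1 wo => [|r l1 IHl] [|g g1] //= wo.
  move=> _.
  transitivity (\sum_(v : (size cs).-tuple bool)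
      (\sum_(k1 : bool) \sum_(k2 : bool)
         vtx s false false k1 k2 * row2 wt b a cs k2 k1 v wo m2 m1) *
      grid wt l2 cs (nseq (size l2) false) g2 wi v).
    rewrite !mulr_sumr.
    under [LHS]eq_bigr do rewrite mulr_sumr mulr_sumr.
    rewrite exchange_big; apply: eq_bigr => v _.
    rewrite !sum_bool !vtx_falses /= !mul0r !add0r /row2 -mulrA; rewrite mulr_suml mulr_sumr.
    by apply: eq_bigr => u _; ring.
  under [LHS]eq_bigr do rewrite row2_swap //.
  under [RHS]eq_bigr do under eq_bigr do
    under eq_bigr do rewrite mulr_sumr.
  under [RHS]eq_bigr do under eq_bigr do
    rewrite exchange_big mulr_suml.
  under [RHS]eq_bigr do rewrite exchange_big.
  rewrite [RHS]exchange_big; apply: eq_bigr => v _.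
  rewrite mulr_suml; apply: eq_bigr => k1 _.
  rewrite mulr_suml; apply: eq_bigr => k2 _.
  rewrite /row2 -mulrA [_ * grid _ _ _ _ _ _ _]mulrC mulrA mulr_suml.
  by congr (_ * _); apply: eq_bigr => u _; ring.
case=> sg; rewrite mulr_sumr.
under [LHS]eq_bigr do rewrite mulrCA (IHl _ _ sg).
under [RHS]eq_bigr do under eq_bigr do rewrite mulr_suml.
under [RHS]eq_bigr do rewrite exchange_big.
rewrite [RHS]exchange_big; apply: eq_bigr => v _.
rewrite mulr_sumr; apply: eq_bigr => k1 _.
by rewrite mulr_sumr; apply: eq_bigr => k2 _; rewrite mulrA.
Qed.

Lemma row_swap_cols wt s r l1 a b l2 h k p p' q q' v1 v2 m1 m2 :
  col_yb s (wt r a) (wt r b) -> size p = size l1 -> size q = size l1 ->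
  \sum_(k1 : bool) \sum_(k2 : bool) vtx s v1 v2 k1 k2 *
     row wt r (l1 ++ b :: a :: l2) h (p ++ k2 :: k1 :: p') (q ++ m2 :: m1 :: q') k
  = \sum_(k1 : bool) \sum_(k2 : bool)
     row wt r (l1 ++ a :: b :: l2) h (p ++ v1 :: v2 :: p') (q ++ k1 :: k2 :: q') k *
     vtx s k1 k2 m1 m2.
Proof.
move=> yb; elim: l1 h p q => [|c l1 IHl] h [|p0 p] [|q0 q] //=.
  move=> _ _.
  transitivity (\sum_(n : bool) (\sum_(k1 : bool) \sum_(k2 : bool)
    vtx s v1 v2 k1 k2 *
     (\sum_(u : bool) vtx (wt r b) h k2 u m2 * vtx (wt r a) u k1 n m1)) *
    row wt r l2 n p' q' k); first by rewrite !sum_bool; ring.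
  under [LHS]eq_bigr do rewrite yb.
  by rewrite !sum_bool; ring.
move=> [sp] [sq].
transitivity (\sum_(u : bool) vtx (wt r c) h p0 u q0 *
  (\sum_(k1 : bool) \sum_(k2 : bool) vtx s v1 v2 k1 k2 *
     row wt r (l1 ++ b :: a :: l2) u (p ++ k2 :: k1 :: p') (q ++ m2 :: m1 :: q') k)).
  by rewrite !sum_bool; ring.
under [LHS]eq_bigr do rewrite (IHl _ _ _ sp sq).
by rewrite !sum_bool; ring.
Qed.

(** The same transport for two columns, row by row: the crossing travels from their bottom ends to
    their top ends. *)
Lemma grid_swap_cols wt s rs l1 a b l2 hi ho p p' q q' v1 v2 m1 m2 :
  {in rs, forall r, col_yb s (wt r a) (wt r b)} ->
  size p = size l1 -> size q = size l1 ->
  \sum_(k1 : bool) \sum_(k2 : bool) vtx s v1 v2 k1 k2 *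
     grid wt rs (l1 ++ b :: a :: l2) hi ho
       (p ++ k2 :: k1 :: p') (q ++ m2 :: m1 :: q')
  = \sum_(k1 : bool) \sum_(k2 : bool)
     grid wt rs (l1 ++ a :: b :: l2) hi ho
       (p ++ v1 :: v2 :: p') (q ++ k1 :: k2 :: q') * vtx s k1 k2 m1 m2.
Proof.
elim: rs hi ho q q' m1 m2 => [|r rs IHrs] [|h hi] [|k ho] q q' m1 m2 yb sp sq /=;
  try by rewrite !sum_bool !mul0r !mulr0 !addr0.
  rewrite !sum_bool !eqseq_cat ?sp ?sq // !eqseq_cons.
  by case: v1; case: v2; case: m1; case: m2; case: (p == q) => //=;
    rewrite ?(mulr0,mul0r,mulr1,mul1r,addr0,add0r) // mulrC.
have ybr : col_yb s (wt r a) (wt r b) by apply: yb; rewrite mem_head.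
have {}yb : {in rs, forall r, col_yb s (wt r a) (wt r b)}.
  by move=> c cin; apply: yb; rewrite inE cin orbT.
under [LHS]eq_bigr do under eq_bigr do rewrite (@sum_tuple_mid _ _ _ l1 l2 b a
  (fun v => row wt r (l1 ++ b :: a :: l2) h v (q ++ m2 :: m1 :: q') k *
     grid wt rs (l1 ++ b :: a :: l2) hi ho _ v)).
under [RHS]eq_bigr do under eq_bigr do rewrite (@sum_tuple_mid _ _ _ l1 l2 a b
  (fun v => row wt r (l1 ++ a :: b :: l2) h v _ k *
     grid wt rs (l1 ++ a :: b :: l2) hi ho (p ++ v1 :: v2 :: p') v)).
transitivity (\sum_(p0 : (size l1).-tuple bool) \sum_(q0 : (size l2).-tuple bool)
   \sum_(n1 : bool) \sum_(n2 : bool)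
   row wt r (l1 ++ b :: a :: l2) h (p0 ++ n2 :: n1 :: q0) (q ++ m2 :: m1 :: q') k *
   (\sum_(k1 : bool) \sum_(k2 : bool) vtx s v1 v2 k1 k2 *
     grid wt rs (l1 ++ b :: a :: l2) hi ho
       (p ++ k2 :: k1 :: p') (p0 ++ n2 :: n1 :: q0))).
  rewrite !sum_bool !mulr_sumr -!big_split /=; apply: eq_bigr => p0 _.
  rewrite !mulr_sumr -!big_split /=; apply: eq_bigr => q0 _.
  by rewrite !sum_bool; ring.
transitivity (\sum_(p0 : (size l1).-tuple bool) \sum_(q0 : (size l2).-tuple bool)
   \sum_(n1 : bool) \sum_(n2 : bool)
   (\sum_(k1 : bool) \sum_(k2 : bool) vtx s n1 n2 k1 k2 *
   row wt r (l1 ++ b :: a :: l2) h (p0 ++ k2 :: k1 :: q0) (q ++ m2 :: m1 :: q') k) *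
     grid wt rs (l1 ++ a :: b :: l2) hi ho
       (p ++ v1 :: v2 :: p') (p0 ++ n1 :: n2 :: q0)).
  apply: eq_bigr => p0 _; apply: eq_bigr => q0 _.
  under [LHS]eq_bigr do under eq_bigr do rewrite IHrs ?size_tuple //.
  by rewrite !sum_bool; ring.
under [LHS]eq_bigr do under eq_bigr do under eq_bigr do under eq_bigr do
  rewrite row_swap_cols ?size_tuple //.
rewrite !sum_bool !mulr_suml -!big_split /=; apply: eq_bigr => p0 _.
rewrite !mulr_suml -!big_split /=; apply: eq_bigr => q0 _.
by rewrite !sum_bool; ring.
Qed.

Lemma falses_mid (S : Type) (l1 l2 : seq S) a b : falses (size (l1 ++ a :: b :: l2))
  = falses (size l1) ++ false :: false :: falses (size l2).
Proof. by rewrite size_cat /falses nseqD. Qed.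

(** A crossing created at the left border leaves the two rows on the right, passes through the flip
    into the two columns, and is absorbed at the top border, where both states are false again. *)
Lemma qtZ_swap wt s l1 a b l2 :
  {in l1 ++ a :: b :: l2, forall c, row_yb s (wt a c) (wt b c)} ->
  {in l1 ++ a :: b :: l2, forall c, col_yb s (wt c a) (wt c b)} ->
  s.1.1 * qtZ wt (l1 ++ b :: a :: l2) = s.1.1 * qtZ wt (l1 ++ a :: b :: l2).
Proof.
move=> ybr ybc; rewrite /qtZ.
rewrite (@sum_tuple_mid _ _ _ l1 l2 b a (fun h => grid wt _ _ _ h (map negb h) _)).
rewrite (@sum_tuple_mid _ _ _ l1 l2 a b (fun h => grid wt _ _ _ h (map negb h) _)).
rewrite !mulr_sumr; apply: eq_bigr => p _; rewrite !mulr_sumr; apply: eq_bigr => q _.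
rewrite !mulr_sumr.
under [LHS]eq_bigr do rewrite mulr_sumr.
transitivity (\sum_(m2 : bool) \sum_(m1 : bool) \sum_(k1 : bool) \sum_(k2 : bool)
   grid wt (l1 ++ a :: b :: l2) (l1 ++ b :: a :: l2)
     (falses (size (l1 ++ a :: b :: l2))) (p ++ k1 :: k2 :: q)
     (map negb p ++ ~~ m2 :: ~~ m1 :: map negb q) (falses (size (l1 ++ b :: a :: l2)))
    * vtx s k1 k2 m1 m2).
  apply: eq_bigr => m2 _; apply: eq_bigr => m1 _; rewrite map_cat /=.
  rewrite grid_swap_rows ?size_tuple // => c cin; apply: ybr.
  by move: cin; rewrite !mem_cat !inE (orbCA (c == b)).
(* Negating all four states does not change [vtx s], so the crossing passes through the flip. *)
transitivity (\sum_(k1 : bool) \sum_(k2 : bool) \sum_(m1 : bool) \sum_(m2 : bool)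
   vtx s (~~ k1) (~~ k2) m1 m2 * 
   grid wt (l1 ++ a :: b :: l2) (l1 ++ b :: a :: l2)
     (falses (size (l1 ++ a :: b :: l2))) (p ++ k1 :: k2 :: q)
     (map negb p ++ m2 :: m1 :: map negb q)
     (falses (size l1) ++ false :: false :: falses (size l2))).
  by rewrite !falses_mid !sum_bool /vtx /=; ring.
apply: eq_bigr => k1 _; rewrite mulr_sumr; apply: eq_bigr => k2 _.
rewrite grid_swap_cols ?size_map ?size_tuple ?size_nseq //.
rewrite !sum_bool !vtx_to_falses /= !mulr0 !add0r map_cat /= !falses_mid mulrC //.
Qed.

End Lattice.

(** * Weights at a cube root of unity, and the symmetry of the partition function *)

Section CubeRootWeights.
Variables (F : fieldType) (w : F).
Hypotheses (w2 : w ^+ 2 = - w - 1) (w_neq1 : w != 1).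
Variable T : eqType.
Implicit Types (x y : F) (X : T -> F).

Definition wgt x y : F * F * F :=
  (w * x ^+ 2 - y ^+ 2, w * y ^+ 2 - x ^+ 2, (w - 1) * x * y).

(* Weights of the auxiliary crossing of two parallel lines. *)
Definition rgt x y : F * F * F :=
  (w * y ^+ 2 - x ^+ 2, w ^+ 2 * (x ^+ 2 - y ^+ 2), (w - 1) * x * y).

(* Normalizing the self-crossings, whose weights wgt x x are proportional to
   (1, 1, 1), keeps the degree of qtZ below the number of interpolation points. *)
Definition lwgt X (l l' : T) := if l == l' then (1, 1, 1) else wgt (X l) (X l').

(** For each of the 64 choices of border states this is a polynomial identity modulo
    [w ^+ 2 + w + 1]. *)
Lemma row_yb_wgt x1 x2 y : row_yb (rgt x1 x2) (wgt x1 y) (wgt x2 y).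
Proof.
by move=> [] [] [] [] [] []; rewrite !sum_bool /vtx /=; ring: w2.
Qed.

Lemma col_yb_wgt x1 x2 y : col_yb (rgt x1 x2) (wgt y x1) (wgt y x2).
Proof.
by move=> [] [] [] [] [] []; rewrite !sum_bool /vtx /=; ring: w2.
Qed.

Lemma w_neq0 : w != 0.
Proof.
apply/eqP => w0; move: w2; rewrite w0 expr0n /= => /eqP.
by rewrite oppr0 sub0r eq_sym oppr_eq0 oner_eq0.
Qed.

Lemma w3 : w ^+ 3 = 1.
Proof. by ring: w2. Qed.

Lemma w2_neq1 : w ^+ 2 != 1.
Proof.
apply: contra w_neq1 => /eqP ww; apply/eqP.
by rewrite -w3 exprS ww mulr1.
Qed.

Definition wscale (t : F) (p : F * F * F) := (t * p.1.1, t * p.1.2, t * p.2).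

Lemma vtx_scale t p h v k u : vtx (wscale t p) h v k u = t * vtx p h v k u.
Proof. by rewrite /vtx; case: ifP => _; [case: ifP | case: ifP; rewrite ?mulr0]. Qed.

Lemma wgt_diag x : wgt x x = wscale ((w - 1) * x ^+ 2) (1, 1, 1).
Proof. by rewrite /wgt /wscale /=; congr (_, _, _); ring. Qed.

(** The equation is homogeneous in [p1] and in [p2]. This admits the normalized self-crossings of
    [lwgt], which are proportional to [wgt x x]. *)
Lemma row_yb_scale s t p1 p2 : t != 0 ->
  (row_yb s (wscale t p1) p2 -> row_yb s p1 p2) *
  (row_yb s p1 (wscale t p2) -> row_yb s p1 p2).
Proof.
by move=> t0; split=> yb h1 h2 v m1 m2 u; apply: (mulfI t0);
  have := yb h1 h2 v m1 m2 u; rewrite !sum_bool !vtx_scale => e;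
  [apply: etrans (etrans e _); ring | apply: etrans (etrans e _); ring].
Qed.

Lemma col_yb_scale s t p1 p2 : t != 0 ->
  (col_yb s (wscale t p1) p2 -> col_yb s p1 p2) *
  (col_yb s p1 (wscale t p2) -> col_yb s p1 p2).
Proof.
by move=> t0; split=> yb h1 h2 v m1 m2 u; apply: (mulfI t0);
  have := yb h1 h2 v m1 m2 u; rewrite !sum_bool !vtx_scale => e;
  [apply: etrans (etrans e _); ring | apply: etrans (etrans e _); ring].
Qed.

Lemma scale_neq0 x : x != 0 -> (w - 1) * x ^+ 2 != 0.
Proof. by move=> x0; rewrite mulf_neq0 ?expf_neq0 ?subr_eq0. Qed.

Lemma row_yb_lwgt X a b c : a != b -> X a != 0 -> X b != 0 ->
  row_yb (rgt (X a) (X b)) (lwgt X a c) (lwgt X b c).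
Proof.
move=> ab a0 b0; rewrite /lwgt; case: eqP => [<-|_].
  rewrite eq_sym (negPf ab); have [H _] := row_yb_scale (rgt (X a) (X b)) (1, 1, 1)
     (wgt (X b) (X a)) (scale_neq0 a0).
  by apply: H; rewrite -wgt_diag; apply: row_yb_wgt.
case: eqP => [<-|_]; last exact: row_yb_wgt.
have [_ H] := row_yb_scale (rgt (X a) (X b)) (wgt (X a) (X b)) (1, 1, 1)
     (scale_neq0 b0).
by apply: H; rewrite -wgt_diag; apply: row_yb_wgt.
Qed.

Lemma col_yb_lwgt X a b c : a != b -> X a != 0 -> X b != 0 ->
  col_yb (rgt (X a) (X b)) (lwgt X c a) (lwgt X c b).
Proof.
move=> ab a0 b0; rewrite /lwgt; case: eqP => [->|_].
  rewrite (negPf ab); have [H _] := col_yb_scale (rgt (X a) (X b)) (1, 1, 1)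
     (wgt (X a) (X b)) (scale_neq0 a0).
  by apply: H; rewrite -wgt_diag; apply: col_yb_wgt.
case: eqP => [->|_]; last exact: col_yb_wgt.
have [_ H] := col_yb_scale (rgt (X a) (X b)) (wgt (X b) (X a)) (1, 1, 1)
     (scale_neq0 b0).
by apply: H; rewrite -wgt_diag; apply: col_yb_wgt.
Qed.

Lemma qtZ_swap_adj X l1 a b l2 : a != b -> X a != 0 -> X b != 0 ->
  qtZ (lwgt X) (l1 ++ b :: a :: l2) = qtZ (lwgt X) (l1 ++ a :: b :: l2).
Proof.
move=> ab a0 b0.
(* The factor [s.1.1] of [qtZ_swap] may vanish. Then the auxiliary crossing with [a] and [b]
   exchanged serves instead, since both factors vanish only if [(w ^+ 2 - 1) * X a ^+ 2 = 0]. *)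
have [E|N] := eqVneq ((rgt (X a) (X b)).1.1) 0; last first.
  apply: (mulfI N); apply: qtZ_swap => c _; first exact: row_yb_lwgt.
  exact: col_yb_lwgt.
have N : (rgt (X b) (X a)).1.1 != 0.
  move: E; rewrite /rgt /= => E; apply/eqP => E'.
  have /eqP : (w ^+ 2 - 1) * X a ^+ 2 = 0.
    rewrite mulrBl mul1r; transitivity (w * (w * X a ^+ 2 - X b ^+ 2) +
      (w * X b ^+ 2 - X a ^+ 2)); first ring.
    by rewrite E E' mulr0 addr0.
  by rewrite mulf_eq0 subr_eq0 (negPf w2_neq1) expf_eq0 /= (negPf a0).
apply/esym/(mulfI N); rewrite eq_sym in ab; apply: qtZ_swap => c _.
  exact: row_yb_lwgt.
exact: col_yb_lwgt.
Qed.

Lemma qtZ_move X s p b q : uniq (s ++ p ++ b :: q) ->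
  {in s ++ p ++ b :: q, forall l, X l != 0} ->
  qtZ (lwgt X) (s ++ p ++ b :: q) = qtZ (lwgt X) (s ++ b :: p ++ q).
Proof.
elim: p s => [|a p IHp] s //= u nz.
rewrite -cat_rcons IHp; rewrite ?cat_rcons //.
apply: qtZ_swap_adj; last first.
- by apply: nz; rewrite !(mem_cat, inE) eqxx !orbT.
- by apply: nz; rewrite !(mem_cat, inE) eqxx !orbT.
move: u; rewrite cat_uniq /= => /and3P [_ _ /andP[]].
by rewrite mem_cat inE !negb_or eq_sym => /and3P[].
Qed.

End CubeRootWeights.

(** * Frozen configurations *)

Section Freezing.
Variables (R : comNzRingType) (T : eqType) (wt : T -> T -> R * R * R).
Implicit Types (rs cs ls : seq T) (hi ho wi wo : seq bool).

Lemma vtx_nocross (p : R * R * R) h v k u :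
  p.2 = 0 -> (h != k) || (v != u) -> vtx p h v k u = 0.
Proof.
by move=> p0; rewrite /vtx p0; case: h; case: v; case: k; case: u.
Qed.

Lemma row_nocross l cs h wi wo k :
  {in cs, forall c, (wt l c).2 = 0} -> h != k -> row wt l cs h wi wo k = 0.
Proof.
elim: cs h wi wo => [|c cs IHcs] h [|v wi] [|q wo] //= c0 hk.
  by rewrite (negPf hk).
rewrite big1 // => u _.
have [hu|hu] := eqVneq h u; last first.
  by rewrite vtx_nocross ?hu ?mul0r // c0 ?mem_head.
rewrite IHcs ?mulr0 -?hu // => c' c'cs; apply: c0.
by rewrite inE c'cs orbT.
Qed.

Lemma grid_nocross l rs cs hi ho v wi q wo :
  {in rs, forall r, (wt r l).2 = 0} -> v != q ->
  grid wt rs (l :: cs) hi ho (v :: wi) (q :: wo) = 0.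
Proof.
elim: rs hi ho q wo => [|r rs IHrs] [|h hi] [|k ho] q wo //= c0 vq.
  by rewrite eqseq_cons (negPf vq).
rewrite (@sum_tupleS _ _ _ (fun t =>
   row wt r (l :: cs) h t (q :: wo) k * grid wt rs (l :: cs) hi ho (v :: wi) t)).
rewrite big1 // => b _; rewrite big1 // => t _ /=.
have [vb|vb] := eqVneq v b; last first.
  rewrite IHrs ?mulr0 // => c' c'cs; apply: c0.
  by rewrite inE c'cs orbT.
rewrite big1 ?mul0r // => u _.
by rewrite vtx_nocross ?mul0r -?vb ?vq ?orbT // c0 ?mem_head.
Qed.

(* Without crossings of type c the states of the first line are the same along
   its row and along its column, which contradicts the flip in between. *)
Lemma qtZ_nocross l ls : wt l l = (1, 1, 1) ->
  {in ls, forall c, (wt l c).2 = 0} -> {in ls, forall c, (wt c l).2 = 0} ->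
  qtZ wt (l :: ls) = 0.
Proof.
move=> dl rl cl; rewrite /qtZ.
rewrite (@sum_tupleS _ _ _ (fun h => grid wt _ _ _ h (map negb h) _)).
rewrite big1 // => h0 _; rewrite big1 // => h _.
rewrite /= (@sum_tupleS _ _ _ (fun t =>
  row wt l (l :: ls) false t (false :: falses (size ls)) h0 *
  grid wt ls (l :: ls) (falses (size ls)) h (~~ h0 :: map negb h) t)).
rewrite big1 // => v0 _; rewrite big1 // => v _ /=.
have [vh|vh] := eqVneq (~~ h0) v0; last by rewrite grid_nocross ?mulr0.
rewrite big1 ?mul0r // => u _.
have [uh|uh] := eqVneq u h0; last by rewrite row_nocross ?mulr0.
by rewrite uh -vh /vtx dl /=; case: (h0); rewrite /= mul0r.
Qed.

(** A crossing conserves the number of true states. With only false states above, a true state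
    coming from the left has to go on to the right, and the whole row is frozen. *)
Lemma row_from_true l cs wi k :
  row wt l cs true wi (falses (size cs)) k
  = if (wi == falses (size cs)) && k then \prod_(c <- cs) (wt l c).1.2 else 0.
Proof.
elim: cs wi => [|c cs IHcs] [|v wi] //=; first by rewrite big_nil; case: k.
rewrite sum_bool !IHcs big_cons /vtx eqseq_cons /=.
by case: v => /=; rewrite ?mul0r ?addr0 //; case: ifP; rewrite ?mulr0.
Qed.

Lemma row_from_false l cs wi :
  row wt l cs false wi (falses (size cs)) false
  = if wi == falses (size cs) then \prod_(c <- cs) (wt l c).1.1 else 0.
Proof.
elim: cs wi => [|c cs IHcs] [|v wi] //=; first by rewrite big_nil.
rewrite sum_bool IHcs row_from_true andbF mulr0 add0r big_cons /vtx eqseq_cons /=.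
by case: v => /=; rewrite ?mul0r //; case: ifP; rewrite ?mulr0.
Qed.

(** No true state enters the first column, from the left or from below, so by conservation it is
    false throughout. *)
Lemma grid_col_false c rs cs ho wi q wo :
  grid wt rs (c :: cs) (falses (size rs)) ho (false :: wi) (q :: wo)
  = if q then 0 else
    \prod_(r <- rs) (wt r c).1.1 * grid wt rs cs (falses (size rs)) ho wi wo.
Proof.
elim: rs ho q wo => [|r rs IHrs] [|k ho] q wo //=;
  rewrite ?mulr0; try by case: q.
  by rewrite big_nil mul1r eqseq_cons eq_sym; case: q.
rewrite (@sum_tupleS _ _ _ (fun t => row wt r (c :: cs) false t (q :: wo) k *
  grid wt rs (c :: cs) (falses (size rs)) ho (false :: wi) t)) sum_bool big1 ?add0r.
  transitivity (\sum_(t : (size cs).-tuple bool) if q then 0 else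
     \prod_(j <- (r :: rs)) (wt j c).1.1 * (row wt r cs false t wo k *
        grid wt rs cs (falses (size rs)) ho wi t)).
    apply: eq_bigr => t _; rewrite IHrs /= sum_bool /vtx /= !mul0r add0r big_cons.
    by case: q => /=; rewrite ?mul0r //; ring.
  by case: q; [rewrite big1 | rewrite mulr_sumr].
by move=> t _; rewrite IHrs mulr0.
Qed.

(** With false states coming from the left, a true state at the top of the first column can only
    have come straight from below. *)
Lemma grid_col_true c rs cs ho p wi wo :
  grid wt rs (c :: cs) (falses (size rs)) ho (p :: wi) (true :: wo)
  = if p then
    \prod_(r <- rs) (wt r c).1.2 * grid wt rs cs (falses (size rs)) ho wi wo
    else 0.
Proof.
elim: rs ho wo => [|r rs IHrs] [|k ho] wo //=;
  rewrite ?mulr0; rewrite ?if_same //.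
  by rewrite big_nil mul1r eqseq_cons; case: (p).
rewrite (@sum_tupleS _ _ _ (fun t => row wt r (c :: cs) false t (true :: wo) k *
  grid wt rs (c :: cs) (falses (size rs)) ho (p :: wi) t)) sum_bool.
rewrite [X in _ + X]big1 ?addr0.
  transitivity (\sum_(t : (size cs).-tuple bool) if p then
     \prod_(j <- (r :: rs)) (wt j c).1.2 * (row wt r cs false t wo k *
        grid wt rs cs (falses (size rs)) ho wi t) else 0).
    apply: eq_bigr => t _; rewrite IHrs /= sum_bool /vtx /= !mul0r add0r big_cons.
    by case: (p) => /=; rewrite ?mulr0 //; ring.
  by case: (p); [rewrite mulr_sumr | rewrite big1].
by move=> t _; rewrite /= sum_bool /vtx /= !mul0r !add0r !mul0r.
Qed.

Lemma sum_tuple1 n (s : seq bool) (f : seq bool -> R) : size s = n ->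
  (forall t, size t = n -> t != s -> f t = 0) ->
  \sum_(t : n.-tuple bool) f t = f s.
Proof.
move=> sn f0; have sz : size s == n by rewrite sn.
rewrite (bigD1 (Tuple sz)) //= big1 ?addr0 // => t ts.
by rewrite f0 ?size_tuple.
Qed.

(** The only surviving configurations have a true state turning from column [l2] into row [l1]. The
    conservation law then fixes every crossing in the rows and columns of [l1] and [l2], with [l1]
    turning in state true and [l2] in state false. *)
Lemma qtZ_freeze l1 l2 ls :
  wt l1 l1 = (1, 1, 1) -> wt l2 l2 = (1, 1, 1) -> (wt l1 l2).1.1 = 0 ->
  qtZ wt [:: l1, l2 & ls] =
    (wt l1 l2).2 * (wt l2 l1).1.1 *
    (\prod_(c <- ls) (wt l1 c).1.2 * \prod_(c <- ls) (wt l2 c).1.1 *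
     \prod_(r <- ls) (wt r l1).1.1 * \prod_(r <- ls) (wt r l2).1.2) *
    qtZ wt ls.
Proof.
move=> d1 d2 a0; rewrite /qtZ; set n := size ls.
pose cs := [:: l1, l2 & ls].
(* Here [v1] and [v2] are the states below the first two crossings of the top row. If both were
   false, the crossing of [l1] with [l2] would have the vanishing weight [(wt l1 l2).1.1]. *)
have row1 v1 v2 v h1 : row wt l1 cs false [:: v1, v2 & v] [:: false, false & falses n] h1
    = if [&& h1, v == falses n & v1 (+) v2] then
        (if v1 then (wt l1 l2).1.2 else (wt l1 l2).2) * \prod_(c <- ls) (wt l1 c).1.2
      else 0.
  rewrite /= !sum_bool !row_from_true -/n /vtx /= d1 /= a0.
  by case: v1; case: v2; case: h1; case: (v == falses n);
    rewrite /= ?(mul0r, mulr0, add0r, addr0, mul1r).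
(* Column [l1] ends in [~~ h1], which is false by [row1]; by [gridE] its state below the second row
   is then false as well. This excludes [v1]. *)
have row2 v1 v2 u2 u h2 : v1 (+) v2 ->
    row wt l2 cs false [:: false, u2 & u] [:: v1, v2 & falses n] h2
    = if [&& ~~ v1, v2 & u2] then
        (wt l2 l1).1.1 * row wt l2 ls false u (falses n) h2
      else 0.
  rewrite /= !sum_bool /vtx /= d2 /=.
  by case: v1; case: v2; case: u2;
    rewrite /= ?(mul0r, mulr0, add0r, addr0, mul1r).
have gridE h2 h u1 u2 u :
    grid wt ls cs (falses n) h [:: false, ~~ h2 & map negb h] [:: u1, u2 & u]
    = if u1 then 0 else \prod_(r <- ls) (wt r l1).1.1 *
        grid wt ls (l2 :: ls) (falses n) h (~~ h2 :: map negb h) (u2 :: u).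
  exact: grid_col_false.
have low h2 h v1 v2 : v1 (+) v2 ->
    \sum_(u : (size cs).-tuple bool)
      row wt l2 cs false u [:: v1, v2 & falses n] h2 *
      grid wt ls cs (falses n) h [:: false, ~~ h2 & map negb h] u
    = if [&& ~~ v1, v2 & ~~ h2] then
        (wt l2 l1).1.1 *
        (\prod_(c <- ls) (wt l2 c).1.1 * \prod_(r <- ls) (wt r l1).1.1 *
         \prod_(r <- ls) (wt r l2).1.2) *
        grid wt ls ls (falses n) h (map negb h) (falses n) else 0.
  move=> v12.
  rewrite (@sum_tupleS _ _ _ (fun u => row wt l2 cs false u [:: v1, v2 & falses n] h2 *
      grid wt ls cs (falses n) h [:: false, ~~ h2 & map negb h] u)) sum_bool.
  rewrite [X in X + _]big1 ?add0r; last first.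
    by case=> [[|u2 u] // su] _; rewrite gridE mulr0.
  rewrite (@sum_tupleS _ _ _ (fun u => row wt l2 cs false (false :: u)
      [:: v1, v2 & falses n] h2 *
      grid wt ls cs (falses n) h [:: false, ~~ h2 & map negb h] (false :: u))) sum_bool.
  rewrite [X in _ + X]big1 ?addr0; last first.
    by move=> u _; rewrite row2 // !andbF mul0r.
  rewrite -/n (@sum_tuple1 _ (falses n) (fun u => row wt l2 cs false [:: false, true & u]
      [:: v1, v2 & falses n] h2 *
      grid wt ls cs (falses n) h [:: false, ~~ h2 & map negb h] [:: false, true & u])).
  - rewrite gridE row2 // grid_col_true.
    case: h2; rewrite ?andbF ?mulr0 // !andbT row_from_false eqxx.
    by case: ifP; rewrite ?mul0r // => _ /=; ring.
  - by rewrite size_nseq.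
  - move=> u su u0; rewrite gridE grid_col_true row2 //.
    by case: h2; rewrite ?mulr0 // row_from_false (negPf u0) mulr0 if_same mul0r.
have all h1 h2 h :
    grid wt cs cs (falses (size cs)) [:: h1, h2 & h]
      [:: ~~ h1, ~~ h2 & map negb h] (falses (size cs))
    = if h1 && ~~ h2 then
        (wt l1 l2).2 * (wt l2 l1).1.1 *
       (\prod_(c <- ls) (wt l1 c).1.2 * \prod_(c <- ls) (wt l2 c).1.1 *
        \prod_(r <- ls) (wt r l1).1.1 * \prod_(r <- ls) (wt r l2).1.2) *
        grid wt ls ls (falses n) h (map negb h) (falses n) else 0.
  have -> : grid wt cs cs (falses (size cs)) [:: h1, h2 & h]
      [:: ~~ h1, ~~ h2 & map negb h] (falses (size cs)) =
    \sum_(v : (size cs).-tuple bool)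
      row wt l1 cs false v [:: false, false & falses n] h1 *
      \sum_(u : (size cs).-tuple bool)
       row wt l2 cs false u v h2 *
       grid wt ls cs (falses n) h [:: ~~ h1, ~~ h2 & map negb h] u by [].
  pose f v := row wt l1 cs false v [:: false, false & falses n] h1 *
      \sum_(u : (size cs).-tuple bool)
       row wt l2 cs false u v h2 *
       grid wt ls cs (falses n) h [:: ~~ h1, ~~ h2 & map negb h] u.
  rewrite (@sum_tupleS _ _ _ f).
  transitivity (\sum_(v1 : bool) \sum_(v2 : bool) f [:: v1, v2 & falses n]).
    apply: eq_bigr => v1 _; rewrite (@sum_tupleS _ _ _ (fun v => f (v1 :: v))).
    apply: eq_bigr => v2 _.
    rewrite (@sum_tuple1 _ (falses n) (fun v => f [:: v1, v2 & v])) ?size_nseq //.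
    by move=> v _ v0; rewrite /f row1 (negPf v0) andbF mul0r.
  rewrite !sum_bool /f !row1; case: (h1) => /=; last by rewrite !mul0r !addr0.
  rewrite !eqxx /= !mul0r add0r addr0 !low //= mulr0 add0r.
  by case: (h2) => /=; rewrite ?mulr0 //; ring.
rewrite (@sum_tupleS _ _ _ (fun h => grid wt _ _ _ h (map negb h) _)).
transitivity (\sum_(h1 : bool) \sum_(h2 : bool) \sum_(h : n.-tuple bool)
  grid wt cs cs (falses (size cs)) [:: h1, h2 & h]
      [:: ~~ h1, ~~ h2 & map negb h] (falses (size cs))).
  apply: eq_bigr => h1 _.
  exact: (@sum_tupleS _ _ _ (fun h => grid wt _ _ _ (h1 :: h) (map negb (h1 :: h)) _)).
transitivity (\sum_(h1 : bool) \sum_(h2 : bool) \sum_(h : n.-tuple bool)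
    (if h1 && ~~ h2 then
        (wt l1 l2).2 * (wt l2 l1).1.1 *
       (\prod_(c <- ls) (wt l1 c).1.2 * \prod_(c <- ls) (wt l2 c).1.1 *
        \prod_(r <- ls) (wt r l1).1.1 * \prod_(r <- ls) (wt r l2).1.2) *
        grid wt ls ls (falses n) h (map negb h) (falses n) else 0)).
  by apply: eq_bigr => h1 _; apply: eq_bigr => h2 _; apply: eq_bigr => h _.
rewrite !sum_bool /= !big1_eq !addr0 add0r.
by rewrite mulr_sumr.
Qed.

End Freezing.

(** * Degree of the partition function *)

Section PolynomialFunctions.
Variable F : idomainType.
Implicit Types (f g : F -> F) (d e : nat).

(** Functions rather than polynomials, so that the weights stay in [F] and only degree bounds are
    carried along. *)
Definition polyfun d f :=
  exists p : {poly F}, (size p <= d.+1)%N /\ forall t, f t = p.[t].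

Lemma polyfunW d e f : (d <= e)%N -> polyfun d f -> polyfun e f.
Proof. by move=> de [p [sp fp]]; exists p; split=> //; apply: leq_trans sp _. Qed.

Lemma polyfun_ext d f g : f =1 g -> polyfun d f -> polyfun d g.
Proof. by move=> fg [p [sp fp]]; exists p; split=> // t; rewrite -fg. Qed.

Lemma polyfun_cst d c : polyfun d (fun=> c).
Proof.
exists c%:P; split; last by move=> t; rewrite hornerC.
by rewrite (leq_trans (size_polyC_leq1 c)).
Qed.

Lemma polyfun_id : polyfun 1 id.
Proof. by exists 'X; rewrite size_polyX; split=> // t; rewrite hornerX. Qed.

Lemma polyfunD d f g : polyfun d f -> polyfun d g -> polyfun d (fun t => f t + g t).
Proof.
move=> [p [sp fp]] [q [sq gq]]; exists (p + q); split; last first.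
  by move=> t; rewrite hornerD fp gq.
by rewrite (leq_trans (size_polyD _ _)) // geq_max sp.
Qed.

Lemma polyfunB d f g : polyfun d f -> polyfun d g -> polyfun d (fun t => f t - g t).
Proof.
move=> [p [sp fp]] [q [sq gq]]; exists (p - q); split; last first.
  by move=> t; rewrite hornerD hornerN fp gq.
by rewrite (leq_trans (size_polyD _ _)) // size_polyN geq_max sp.
Qed.

Lemma polyfunM d e f g :
  polyfun d f -> polyfun e g -> polyfun (d + e) (fun t => f t * g t).
Proof.
move=> [p [sp fp]] [q [sq gq]]; exists (p * q); split; last first.
  by move=> t; rewrite hornerM fp gq.
rewrite (leq_trans (size_polyMleq _ _)) // -subn1 leq_subLR add1n.
by rewrite (leq_trans (leq_add sp sq)) // addnS addSn.
Qed.

Lemma polyfunX d f n : polyfun d f -> polyfun (n * d) (fun t => f t ^+ n).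
Proof.
move=> pf; elim: n => [|n IHn]; first exact: polyfun_cst.
by rewrite mulSn; apply: polyfun_ext (polyfunM pf IHn) => t; rewrite exprS.
Qed.

Lemma polyfun_sum d (I : Type) (r : seq I) (P : pred I) (f : I -> F -> F) :
  (forall i, P i -> polyfun d (f i)) -> polyfun d (fun t => \sum_(i <- r | P i) f i t).
Proof.
move=> pf; elim: r => [|i r IHr].
  by apply: polyfun_ext (polyfun_cst _ 0) => t; rewrite big_nil.
case Pi : (P i); last by apply: polyfun_ext IHr => t; rewrite big_cons Pi.
by apply: polyfun_ext (polyfunD (pf i Pi) IHr) => t; rewrite big_cons Pi.
Qed.

Lemma polyfun_eq0 d f (rs : seq F) : polyfun d f -> uniq rs -> (d < size rs)%N ->
  {in rs, forall t, f t = 0} -> forall t, f t = 0.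
Proof.
move=> [p [sp fp]] urs srs f0 t; rewrite fp.
suff -> : p = 0 by rewrite horner0.
apply: (roots_geq_poly_eq0 (rs := rs)) => //; last exact: leq_trans sp srs.
by apply/allP => s srs'; rewrite rootE -fp f0.
Qed.

End PolynomialFunctions.

Section LatticeDegree.
Variables (F : idomainType) (T : eqType) (wt : F -> T -> T -> F * F * F).
Variable d : T -> T -> nat.
Hypothesis wt_poly : forall l l',
  [/\ polyfun (d l l') (fun t => (wt t l l').1.1),
      polyfun (d l l') (fun t => (wt t l l').1.2) &
      polyfun (d l l') (fun t => (wt t l l').2)].

Lemma polyfun_vtx l l' h v k u : polyfun (d l l') (fun t => vtx (wt t l l') h v k u).
Proof.
have [pa pb pc] := wt_poly l l'; rewrite /vtx.
by case: h; case: v; case: k; case: u => //=; apply: polyfun_cst.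
Qed.

Lemma polyfun_row l cs h wi wo k :
  polyfun (\sum_(c <- cs) d l c) (fun t => row (wt t) l cs h wi wo k).
Proof.
elim: cs h wi wo => [|c cs IHcs] h [|v wi] [|q wo]; try exact: polyfun_cst.
rewrite big_cons; apply: polyfun_sum => u _.
by apply: polyfunM; [apply: polyfun_vtx | apply: IHcs].
Qed.

Lemma polyfun_grid rs cs hi ho wi wo :
  polyfun (\sum_(r <- rs) \sum_(c <- cs) d r c)
    (fun t => grid (wt t) rs cs hi ho wi wo).
Proof.
elim: rs hi ho wo => [|r rs IHrs] [|h hi] [|k ho] wo; try exact: polyfun_cst.
rewrite big_cons; apply: polyfun_sum => v _.
by apply: polyfunM; [apply: polyfun_row | apply: IHrs].
Qed.

Lemma polyfun_qtZ ls :
  polyfun (\sum_(r <- ls) \sum_(c <- ls) d r c) (fun t => qtZ (wt t) ls).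
Proof. by apply: polyfun_sum => h _; apply: polyfun_grid. Qed.

End LatticeDegree.

(** * Rescaling of the weights *)

Section LatticeScaling.
Variables (F : fieldType) (T : eqType) (wt : T -> T -> F * F * F).
Variable s : T -> T -> F.
Let swt l l' := wscale (s l l') (wt l l').

Lemma row_scale l cs h wi wo k :
  row swt l cs h wi wo k = \prod_(c <- cs) s l c * row wt l cs h wi wo k.
Proof.
elim: cs h wi wo => [|c cs IHcs] h [|v wi] [|q wo] //=; rewrite ?mulr0 //.
  by rewrite big_nil mul1r.
rewrite mulr_sumr; apply: eq_bigr => u _.
by rewrite vtx_scale IHcs big_cons mulrACA.
Qed.

Lemma grid_scale rs cs hi ho wi wo :
  grid swt rs cs hi ho wi wo =
  \prod_(r <- rs) \prod_(c <- cs) s r c * grid wt rs cs hi ho wi wo.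
Proof.
elim: rs hi ho wo => [|r rs IHrs] [|h hi] [|k ho] wo //=; rewrite ?mulr0 //.
  by rewrite big_nil mul1r.
rewrite mulr_sumr; apply: eq_bigr => v _.
by rewrite row_scale IHrs big_cons mulrACA.
Qed.

Lemma qtZ_scale ls :
  qtZ swt ls = \prod_(r <- ls) \prod_(c <- ls) s r c * qtZ wt ls.
Proof. by rewrite mulr_sumr; apply: eq_bigr => h _; rewrite grid_scale. Qed.

End LatticeScaling.

(** * Alternants *)

Section Alternants.
Variable F : fieldType.
Implicit Types (e : nat -> nat) (X Y : seq F) (x t : F) (n : nat).

Definition altmx n e X : 'M[F]_n := \matrix_(i < n, j < n) X`_i ^+ e j.

Definition alt e X : F := \det (altmx (size X) e X).

(** The sign does not depend on [e], so a product of four alternants with any exponents is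
    symmetric. *)
Lemma alt_perm X Y : perm_eq X Y -> exists b : bool, forall e, alt e Y = (-1) ^+ b * alt e X.
Proof.
move=> XY; have sX : size X == size Y by rewrite (perm_size XY).
have := XY; rewrite perm_sym => YX.
have /tuple_permP[p Ep] : perm_eq Y (in_tuple X) by [].
exists (odd_perm p) => e; rewrite /alt.
have -> : \det (altmx (size Y) e Y) = \det (altmx (size X) e Y).
  by rewrite (eqP sX).
rewrite -det_perm -det_mulmx -row_permE; congr (\det _).
apply/matrixP => i j; rewrite !mxE Ep; congr (_ ^+ _).
by rewrite -(tnth_nth 0 [tuple tnth (in_tuple X) (p i)  | i < size X]) tnth_mktuple
  (tnth_nth 0).
Qed.

(* Subtracting x0^3 times column j from column j + 2 leaves zeros in the first two
   rows outside of the first two columns. *)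
Lemma alt_rec e x0 x1 X : (forall j, e j.+2 = (e j + 3)%N) -> e 0%N = 0%N ->
  x1 ^+ 3 = x0 ^+ 3 ->
  alt e [:: x0, x1 & X] =
    (x1 ^+ e 1%N - x0 ^+ e 1%N) * \prod_(x <- X) (x ^+ 3 - x0 ^+ 3) * alt e X.
Proof.
move=> eS e0 x13; rewrite /alt; set n := size X.
(* Multiplication by the unitriangular matrix [U] on the right performs all these column operations
   at once. *)
pose U : 'M[F]_(2 + n) :=
  \matrix_(i, j) ((i == j)%:R - ((i.+2 == j :> nat)%:R * x0 ^+ 3)).
have detU : \det U = 1.
  rewrite -det_tr det_trig; last first.
    apply/is_trig_mxP => i j ij; rewrite !mxE.
    rewrite -val_eqE /= (gtn_eqF ij).
    by rewrite gtn_eqF ?mul0r ?subr0 // (ltn_trans ij) // ltnS ltnW.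
  apply: big1 => i _; rewrite !mxE eqxx.
  by rewrite gtn_eqF ?mul0r ?subr0 // ltnS ltnW.
pose M : 'M[F]_(2 + n) := altmx (2 + n) e [:: x0, x1 & X].
pose A : 'M[F]_2 := altmx 2 e [:: x0; x1].
pose B : 'M[F]_n := diag_mx (\row_i (X`_i ^+ 3 - x0 ^+ 3)) *m altmx n e X.
have BE i j : B i j = (X`_i ^+ 3 - x0 ^+ 3) * X`_i ^+ e j.
  by rewrite /B mul_diag_mx !mxE.
have MU i (j : 'I_(2 + n)) : (M *m U) i j =
    M i j - (if (2 <= j)%N then [:: x0, x1 & X]`_i ^+ e (j - 2)%N * x0 ^+ 3 else 0).
  rewrite mxE.
  under eq_bigr do rewrite [U _ _]mxE mulrBr.
  rewrite big_split /= sumrN; congr (_ - _).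
    rewrite (bigD1 j) //= eqxx mulr1 big1 ?addr0 // => k kj.
    by rewrite (negPf kj) mulr0.
  case: ifP => j2; last first.
    rewrite big1 // => k _; rewrite gtn_eqF ?mul0r ?mulr0 //.
    by move/negbT: j2; rewrite -ltnNge => j2; apply: (leq_trans j2).
  have j2n : (j - 2 < 2 + n)%N by rewrite (leq_ltn_trans (leq_subr _ _)).
  rewrite (bigD1 (Ordinal j2n)) //= big1 ?addr0.
    rewrite mxE /=; have -> : ((j - 2).+2 == j :> nat) by apply/eqP; lia.
    by rewrite mul1r.
  move=> k kj.
  case: eqP => [E|]; last by rewrite mul0r mulr0.
  by case/eqP: kj; apply: val_inj => /=; lia.
have -> : \det (altmx (size [:: x0, x1 & X]) e [:: x0, x1 & X]) = \det (M *m U).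
  by rewrite det_mulmx detU mulr1.
(* The upper right block vanishes, in its first row by construction and in its second because
   [x1 ^+ 3 = x0 ^+ 3]. *)
have -> : M *m U = block_mx A 0 (\matrix_(i < n, j < 2) X`_i ^+ e j) B.
  apply/matrixP => i j; rewrite MU mxE.
  case: (split_ordP i) => {}i ->; case: (split_ordP j) => {}j ->;
    rewrite ?(block_mxEul, block_mxEur, block_mxEdl, block_mxEdr) ?BE ?mxE /=.
  - by rewrite leqNgt ltn_ord subr0; case: i => [[|[|]]].
  - rewrite addKn -[(2 + j)%N]/(j.+2) eS exprD; case: i => [[|[|[]]]] //= _; rewrite ?x13 subrr //.
  - by rewrite leqNgt ltn_ord subr0.
  - rewrite addKn -[(2 + j)%N]/(j.+2) eS exprD mulrBl.
    by rewrite mulrC [_ * x0 ^+ 3]mulrC.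
rewrite det_lblock /B det_mulmx det_diag mulrA; congr (_ * _ * _).
  rewrite (expand_det_row _ ord0) !big_ord_recl big_ord0 /cofactor !det_mx11 !mxE /=.
  by rewrite /bump /= e0; ring.
rewrite (big_nth 0) big_mkord; apply: eq_bigr => i _; rewrite mxE //.
Qed.

Lemma alt_id X : alt id X = \prod_(i < size X) \prod_(j < size X | (i < j)%N) (X`_j - X`_i).
Proof.
rewrite /alt -det_tr.
have -> : (altmx (size X) id X)^T = Vandermonde (size X) (\row_(i < size X) X`_i).
  by apply/matrixP => i j; rewrite !mxE.
rewrite det_Vandermonde; apply: eq_bigr => i _; apply: eq_bigr => j _.
by rewrite !mxE.
Qed.

Lemma alt_id_cons x X : alt id (x :: X) = \prod_(y <- X) (y - x) * alt id X.
Proof.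
rewrite !alt_id big_ord_recl; congr (_ * _).
  rewrite big_mkcond big_ord_recl /= mul1r (big_nth 0) big_mkord.
  by apply: eq_bigr.
apply: eq_bigr => i _; rewrite big_mkcond big_ord_recl /= mul1r [RHS]big_mkcond.
by apply: eq_bigr.
Qed.

(** At a geometric sequence the matrix is also a Vandermonde matrix in the numbers [t ^+ e j], so
    the alternant factors for every choice of exponents. *)
Lemma alt_geom e t n : alt e [seq t ^+ i | i <- iota 0 n] =
  \prod_(i < n) \prod_(j < n | (i < j)%N) (t ^+ e j - t ^+ e i).
Proof.
rewrite /alt size_map size_iota.
have -> : altmx n e [seq t ^+ i | i <- iota 0 n] = Vandermonde n (\row_j t ^+ e j).
  apply/matrixP => i j; rewrite !mxE (nth_map 0%N) ?size_iota // nth_iota //.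
  by rewrite add0n -!exprM mulnC.
rewrite det_Vandermonde; apply: eq_bigr => i _; apply: eq_bigr => j _.
by rewrite !mxE.
Qed.

(** As a polynomial in its first variable the alternant has degree at most [E], and it vanishes
    whenever this variable equals one of the others. *)
Lemma alt_factor e E X : uniq X -> (forall j, (j <= size X)%N -> (e j <= E)%N) ->
  exists q : F -> F, polyfun (E - size X) q /\
    forall t, alt e (t :: X) = q t * \prod_(x <- X) (t - x).
Proof.
move=> uX eE; set n := size X.
(* These cofactors omit row 0, so the entry 0 is only a placeholder for [t]. *)
pose c j := cofactor (altmx n.+1 e (0 :: X)) ord0 j.
have altE t : alt e (t :: X) = \sum_(j < n.+1) t ^+ e j * c j.
  rewrite /alt (expand_det_row _ ord0); apply: eq_bigr => j _.
  rewrite mxE /=; congr (_ * _); rewrite /c /cofactor; congr (_ * \det _).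
  by apply/matrixP => k l; rewrite !mxE.
pose p : {poly F} := \sum_(j < n.+1) c j *: 'X^(e j).
have pE t : p.[t] = alt e (t :: X).
  rewrite altE /p horner_sum; apply: eq_bigr => j _.
  by rewrite hornerZ hornerXn mulrC.
have sp : (size p <= E.+1)%N.
  apply: (leq_trans (size_sum _ _ _)); apply/bigmax_leqP => j _.
  by rewrite (leq_trans (size_scale_leq _ _)) // size_polyXn ltnS eE // -ltnS.
have rp : all (root p) X.
  apply/allP => x xX; rewrite rootE pE; apply/eqP.
  have ix : ((index x X).+1 < (size X).+1)%N by rewrite ltnS index_mem.
  apply: (@determinant_alternate _ _ _ ord0 (Ordinal ix)) => // j.
  by rewrite !mxE /= nth_index.
have /(uniq_roots_prod_XsubC rp)[q Eq] : uniq_roots X by rewrite uniq_rootsE.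
exists (horner q); split; last first.
  move=> t; rewrite -pE Eq hornerM horner_prod; congr (_ * _).
  by apply: eq_bigr => x _; rewrite hornerXsubC.
exists q; split=> //.
have [->|q0] := eqVneq q 0; first by rewrite size_poly0.
move: sp; rewrite Eq size_Mmonic ?monic_prod_XsubC // size_prod_XsubC addnS /=.
by move/(leq_sub2r n); rewrite addnK => /leq_trans; apply; rewrite leq_subLR addnS ltnS -leq_subLR.
Qed.

End Alternants.

(** * Evaluation of the partition function *)

Section PartitionFunction.
Variables (F : numFieldType) (w : F).
Hypotheses (w2 : w ^+ 2 = - w - 1) (w_neq1 : w != 1).
Variable T : eqType.
Implicit Types (X : T -> F) (ls : seq T).

(* The j-th natural number congruent to 0 or 1 modulo 3, resp. to 0 or 2. *)
Definition exp01 j := (3 * j./2 + odd j)%N.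
Definition exp02 j := (3 * j./2 + 2 * odd j)%N.

Definition sqs X ls := [seq X l ^+ 2 | l <- ls].

Definition qtZ_const m : F := \prod_(i < m) ((w - 1) ^+ 2 * w ^+ (4 * i)).

Definition qtZ_formula X ls m :=
  qtZ (lwgt w X) ls * alt id (sqs X ls) ^+ 4
  = qtZ_const m * \prod_(l <- ls) X l * alt exp01 (sqs X ls) ^+ 3 * alt exp02 (sqs X ls).

(** Each side contains four alternants, and all of them change by the same sign. *)
Lemma qtZ_formula_perm X ls ls' m : perm_eq ls ls' ->
  qtZ (lwgt w X) ls = qtZ (lwgt w X) ls' ->
  qtZ_formula X ls m -> qtZ_formula X ls' m.
Proof.
move=> pls eZ; rewrite /qtZ_formula -eZ.
have [b Eb] := alt_perm (perm_map (fun l => X l ^+ 2) pls).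
rewrite /sqs !Eb -(perm_big _ pls) => H.
by case: (b); rewrite ?expr1 ?expr0; apply: etrans (etrans H _); ring.
Qed.

(** The crossing of [a] with [b] has vanishing weight [w * X a ^+ 2 - X b ^+ 2], so the left side
    freezes; [alt_rec] and [alt_id_cons] split the same two lines off the alternants. *)
Lemma qtZ_formula_step X a b ls m : uniq [:: a, b & ls] -> size ls = (2 * m)%N ->
  X b ^+ 2 = w * X a ^+ 2 -> qtZ_formula X ls m -> qtZ_formula X [:: a, b & ls] m.+1.
Proof.
move=> uls sls ab IH; move: uls; rewrite /= inE negb_or => /andP[/andP[nab als] /andP[bls uls]].
have neq l : l \in ls ->
    [/\ (a == l) = false, (l == a) = false, (b == l) = false & (l == b) = false].
  move=> lls; split; apply/negP => /eqP E; first [by rewrite E lls in als | by rewrite -E lls in als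
    | by rewrite E lls in bls | by rewrite -E lls in bls].
rewrite /qtZ_formula qtZ_freeze ?/lwgt ?eqxx //; last first.
  by rewrite (negPf nab) /= ab subrr.
rewrite (negPf nab) eq_sym (negPf nab).
have -> : \prod_(c <- ls) (if a == c then (1, 1, 1) else wgt w (X a) (X c)).1.2 =
  \prod_(c <- ls) (w * X c ^+ 2 - X a ^+ 2).
  by apply: eq_big_seq => c /neq[-> _ _ _].
have -> : \prod_(c <- ls) (if b == c then (1, 1, 1) else wgt w (X b) (X c)).1.1 =
  \prod_(c <- ls) (w * X b ^+ 2 - X c ^+ 2).
  by apply: eq_big_seq => c /neq[_ _ -> _].
have -> : \prod_(c <- ls) (if c == a then (1, 1, 1) else wgt w (X c) (X a)).1.1 =
  \prod_(c <- ls) (w * X c ^+ 2 - X a ^+ 2).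
  by apply: eq_big_seq => c /neq[_ -> _ _].
have -> : \prod_(c <- ls) (if c == b then (1, 1, 1) else wgt w (X c) (X b)).1.2 =
  \prod_(c <- ls) (w * X b ^+ 2 - X c ^+ 2).
  by apply: eq_big_seq => c /neq[_ _ _ ->].
rewrite -/(lwgt w X) /= !alt_id_cons.
have w3 := w3 w2.
have ab3 : (X b ^+ 2) ^+ 3 = (X a ^+ 2) ^+ 3 by rewrite ab exprMn w3 mul1r.
have eS1 j : exp01 j.+2 = (exp01 j + 3)%N by rewrite /exp01 /= negbK; lia.
have eS2 j : exp02 j.+2 = (exp02 j + 3)%N by rewrite /exp02 /= negbK; lia.
rewrite !alt_rec // !big_cons /= !big_map.
rewrite (_ : exp01 1 = 1)%N // (_ : exp02 1 = 2)%N // !expr1.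
set Pa := \prod_(c <- ls) (w * _ - X a ^+ 2).
set Pb := \prod_(c <- ls) (w * X b ^+ 2 - _).
set Qa := \prod_(c <- ls) (_ - X a ^+ 2).
set Qb := \prod_(c <- ls) (_ - X b ^+ 2).
set Q3 := \prod_(c <- ls) (_ - (X a ^+ 2) ^+ 3).
(* For each [c], [X c ^+ 6 - X a ^+ 6] splits over the cube roots of unity. [Qa] and [Qb] supply two
   of the factors; [Pa * Pb] supplies the square of the third, times [- w]. *)
have PQ : Pa * Pb * Pa * Pb * (Qa * Qb) ^+ 4 = w ^+ (4 * m) * Q3 ^+ 4.
  rewrite /Pa /Pb /Qa /Qb /Q3 -!big_split /= -!prodrXl -big_split /=.
  have -> : w ^+ (4 * m) = \prod_(c <- ls) w ^+ 2.
    by rewrite big_const_seq count_predT sls iter_mulr_1 -exprM; congr (_ ^+ _); lia.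
  rewrite -big_split /=; apply: eq_bigr => c _; rewrite ab.
  have -> : (X c ^+ 2) ^+ 3 - (X a ^+ 2) ^+ 3 = (X c ^+ 2 - X a ^+ 2) *
    (X c ^+ 2 - w * X a ^+ 2) * (X c ^+ 2 - w ^+ 2 * X a ^+ 2) by ring: w2.
  have -> : w * X c ^+ 2 - X a ^+ 2 = w * (X c ^+ 2 - w ^+ 2 * X a ^+ 2).
    by ring: w2.
  have -> : w * (w * X a ^+ 2) - X c ^+ 2 = - (X c ^+ 2 - w ^+ 2 * X a ^+ 2) by ring.
  ring.
rewrite /qtZ_const big_ord_recr /= -/(qtZ_const m).
set Z := qtZ _ _; set D := alt id _; set D1 := alt exp01 _; set D2 := alt exp02 _.
set P := \prod_(l <- ls) _.
have {}IH : Z * D ^+ 4 = qtZ_const m * P * D1 ^+ 3 * D2 by [].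
transitivity ((w - 1) * X a * X b * (w * X b ^+ 2 - X a ^+ 2) * (X b ^+ 2 - X a ^+ 2) ^+ 4
   * (Pa * Pb * Pa * Pb * (Qa * Qb) ^+ 4) * (Z * D ^+ 4)); first by ring.
rewrite PQ IH.
transitivity ((w - 1) ^+ 2 * w ^+ (4 * m) * (X a * X b) * (X b ^+ 2 - X a ^+ 2) ^+ 3 *
  ((X b ^+ 2) ^+ 2 - (X a ^+ 2) ^+ 2) * (Q3 ^+ 4) * (qtZ_const m * P * D1 ^+ 3 * D2)); last by ring.
(* Only factors of the pair [a], [b] remain. Both sides are
   [(w - 1) ^+ 5 * (w ^+ 2 - 1) * X a ^+ 10] times [X a * X b]. *)
suff -> : (w - 1) * X a * X b * (w * X b ^+ 2 - X a ^+ 2) * (X b ^+ 2 - X a ^+ 2) ^+ 4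
  = (w - 1) ^+ 2 * (X a * X b) * (X b ^+ 2 - X a ^+ 2) ^+ 3 *
  ((X b ^+ 2) ^+ 2 - (X a ^+ 2) ^+ 2) by ring.
rewrite ab; ring: w2.
Qed.

Lemma polyfun_sqr d (f : F -> F) : polyfun d f -> polyfun (2 * d) (fun t => f (t ^+ 2)).
Proof.
move=> [p [sp fp]]; exists (p \Po 'X^2); split; last first.
  by move=> t; rewrite horner_comp hornerXn fp.
rewrite (leq_trans (size_comp_poly_leq _ _)) // size_polyXn ltnS mulnC leq_mul2l /=.
by case: (size p) sp.
Qed.

Lemma eq_qtZ (wt wt' : T -> T -> F * F * F) ls :
  (forall l l', wt l l' = wt' l l') -> qtZ wt ls = qtZ wt' ls.
Proof.
move=> ww; have eR l cs h wi wo k : row wt l cs h wi wo k = row wt' l cs h wi wo k.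
  elim: cs h wi wo => [|c cs IHcs] h [|v wi] [|q wo] //=.
  by apply: eq_bigr => u _; rewrite ww IHcs.
have eG rs cs hi ho wi wo : grid wt rs cs hi ho wi wo = grid wt' rs cs hi ho wi wo.
  elim: rs hi ho wo => [|r rs IHrs] [|h hi] [|k ho] wo //=.
  by apply: eq_bigr => v _; rewrite eR IHrs.
exact: eq_bigr.
Qed.

Definition setX X l1 t := fun l => if l == l1 then t else X l.

Lemma eq_qtZ_formula X Y ls m : X =1 Y -> qtZ_formula X ls m -> qtZ_formula Y ls m.
Proof.
move=> XY; rewrite /qtZ_formula /sqs.
rewrite (@eq_qtZ _ (lwgt w Y)); last by move=> l l'; rewrite /lwgt !XY.
rewrite (eq_map (g := fun l => Y l ^+ 2)); last by move=> l; rewrite XY.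
by rewrite (eq_bigr Y).
Qed.

(** Line [l1] meets every other line twice, once in its row and once in its column, each time with
    degree at most 2 in [t]. Its self-crossing is constant. *)
Lemma polyfun_qtZ_setX X l1 ls : uniq (l1 :: ls) ->
  polyfun (4 * size ls) (fun t => qtZ (lwgt w (setX X l1 t)) (l1 :: ls)).
Proof.
move=> /= /andP[l1ls uls].
pose d (l l' : T) := if l == l' then 0%N else if (l == l1) || (l' == l1) then 2%N else 0%N.
have pX (c : F) : polyfun 2 (fun t => c * t ^+ 2).
  apply: (@polyfunM _ 0 2); first exact: polyfun_cst.
  by apply: (@polyfunX _ 1 id 2); apply: polyfun_id.
have wp l l' : [/\ polyfun (d l l') (fun t => (lwgt w (setX X l1 t) l l').1.1),
      polyfun (d l l') (fun t => (lwgt w (setX X l1 t) l l').1.2) &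
      polyfun (d l l') (fun t => (lwgt w (setX X l1 t) l l').2)].
  rewrite /d /lwgt /setX; case: (l =P l') => [_|ll']; first by split; apply: polyfun_cst.
  case: (l =P l1) => [ll1|_]; case: (l' =P l1) => [l'l1|_] /=.
  - by rewrite ll1 l'l1 in ll'.
  - split.
    + by apply: polyfunB; [apply: pX|apply: polyfun_cst].
    + apply: polyfunB; [exact: polyfun_cst | apply: (@polyfunX _ 1 id 2); exact: polyfun_id].
    + apply: (@polyfunM _ 1 1); last exact: polyfun_cst.
      by apply: (@polyfunM _ 0 1); [apply: polyfun_cst | apply: polyfun_id].
  - split.
    + apply: polyfunB; [exact: polyfun_cst | apply: (@polyfunX _ 1 id 2); exact: polyfun_id].
    + by apply: polyfunB; [apply: pX|apply: polyfun_cst].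
    + by apply: (@polyfunM _ 1 1); [apply: polyfun_cst | apply: polyfun_id].
  - by split; apply: polyfun_cst.
apply: polyfunW (polyfun_qtZ wp (l1 :: ls)).
have dl : {in ls, forall l, (l1 == l) = false}.
  by move=> l lls; apply/negP => /eqP E; rewrite E lls in l1ls.
have E1 : (\sum_(c <- l1 :: ls) d l1 c = 2 * size ls)%N.
  rewrite big_cons {1}/d eqxx add0n -sum1_size big_distrr /=.
  by apply: eq_big_seq => l lls; rewrite /d dl // eqxx.
have E2 : {in ls, forall l, (\sum_(c <- l1 :: ls) d l c = 2)%N}.
  move=> l lls; rewrite big_cons {1}/d eq_sym dl // eqxx orbT big1_seq ?addn0 // => c /= cls.
  by rewrite /d ![_ == l1]eq_sym !dl //= if_same.
rewrite big_cons E1 (eq_big_seq (fun=> 2%N) E2) big_const_seq count_predT iter_addn.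
lia.
Qed.

(** By induction on [m]. The parameter of the first line becomes a variable [t], and the two sides
    are compared at more points than their degree; distinct sixth powers keep these points
    distinct. *)
Theorem qtZ_formula_generic X ls m : uniq ls -> size ls = (2 * m)%N ->
  {in ls, forall l, X l != 0} -> {in ls &, injective (fun l => X l ^+ 6)} ->
  qtZ_formula X ls m.
Proof.
elim: m X ls => [|m IHm] X ls.
  case: ls => // _ _ _ _; rewrite /qtZ_formula /qtZ /qtZ_const.
  rewrite (@sum_tuple0 _ _ (fun h => grid (lwgt w X) [::] [::] [::] h (map negb h) [::])).
  rewrite big_ord0 big_nil /alt !det_mx00 /= expr1n; ring.
case: ls => [|l1 ls] //=.
move=> /andP[l1ls uls] [sls] X0 inj.
have {}sls : size ls = (2 * m).+1 by lia.
pose S := sqs X ls.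
have XXl t : {in ls, setX X l1 t =1 X}.
  by move=> l lls; rewrite /setX; case: eqP => // E; rewrite -E lls in l1ls.
have XX1 t : setX X l1 t l1 = t by rewrite /setX eqxx.
have SS t : sqs (setX X l1 t) (l1 :: ls) = t ^+ 2 :: S.
  by rewrite /sqs /= XX1; congr (_ :: _); apply/eq_in_map => l lls; rewrite XXl.
have sS : size S = (2 * m).+1 by rewrite size_map.
have inj2 : {in ls &, injective (fun l => X l ^+ 2)}.
  move=> a b als bls /(congr1 (fun y => y ^+ 3)); rewrite -!exprM.
  by apply: inj; rewrite inE ?als ?bls orbT.
have uS : uniq S by rewrite map_inj_in_uniq.
have [q1 [pq1 Eq1]] : exists q, polyfun (3 * m + 1 - size S) q /\
    forall t, alt exp01 (t :: S) = q t * \prod_(x <- S) (t - x).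
  by apply: alt_factor => // j; rewrite sS /exp01; lia.
have [q2 [pq2 Eq2]] : exists q, polyfun (3 * m + 2 - size S) q /\
    forall t, alt exp02 (t :: S) = q t * \prod_(x <- S) (t - x).
  by apply: alt_factor => // j; rewrite sS /exp02; lia.
pose P := \prod_(l <- ls) X l.
(* By [alt_factor] both sides contain the fourth power of [\prod_(x <- S) (t ^+ 2 - x)]. Dividing it
   out lowers the degree to at most [4 * (2 * m).+1], but makes [f] equivalent to the formula only
   where this product is nonzero. *)
pose f t := qtZ (lwgt w (setX X l1 t)) (l1 :: ls) * alt id S ^+ 4 -
  qtZ_const m.+1 * P * (t * (q1 (t ^+ 2) ^+ 3 * q2 (t ^+ 2))).
have fE t : {in S, forall y, t ^+ 2 != y} ->
    f t = 0 <-> qtZ_formula (setX X l1 t) (l1 :: ls) m.+1.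
  move=> tS; rewrite /f /qtZ_formula SS Eq1 Eq2 alt_id_cons big_cons XX1.
  rewrite (eq_big_seq (fun l => X l)); last by move=> l lls; rewrite XXl.
  rewrite -/P; set Z := qtZ _ _; set D := alt id S.
  have -> : \prod_(y <- S) (y - t ^+ 2) = (-1) ^+ size S * \prod_(x <- S) (t ^+ 2 - x).
    elim: (S) => [|y s IHs]; first by rewrite !big_nil mul1r.
    by rewrite !big_cons IHs /= [(-1) ^+ _.+1]exprS; ring.
  set Q := \prod_(x <- S) _.
  have Q0 : Q ^+ 4 != 0.
    rewrite expf_neq0 // prodf_seq_neq0; apply/allP => y yS.
    by rewrite subr_eq0 tS.
  rewrite 2!exprMn -exprM (_ : (size S * 4 = 2 * (2 * size S))%N); last by lia.
  rewrite exprM sqrrN expr1n expr1n mul1r.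
  split=> [/eqP|H]; rewrite ?subr_eq0.
    move/eqP=> H; transitivity (Z * D ^+ 4 * Q ^+ 4); first ring.
    by rewrite H; ring.
  apply/eqP; rewrite subr_eq0; apply/eqP/(mulIf Q0).
  apply: etrans (etrans H _); ring.
(* For these [z] the square is [w ^+ 2] or [w], so lines with parameters [z * X l] and [X l] freeze
   in one of their two orders. Together with 0 this gives one point more than the degree bound. *)
pose zs : seq F := [:: w; - w; w ^+ 2; - w ^+ 2].
pose rs : seq F := 0 :: [seq z * X l | l <- ls, z <- zs].
have w0 : w != 0 := w_neq0 w2.
have w21 : w ^+ 2 != 1 := w2_neq1 w2 w_neq1.
have zs0 : {in zs, forall z, z != 0}.
  by move=> z; rewrite !inE => /or4P[] /eqP->; rewrite ?oppr_eq0 ?expf_neq0.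
have zs2 : {in zs, forall z, (z ^+ 2 == w ^+ 2) || (z ^+ 2 == w)}.
  move=> z; rewrite !inE => /or4P[] /eqP->; rewrite ?sqrrN ?eqxx //;
  by apply/orP; right; apply/eqP; ring: w2.
have zs6 : {in zs, forall z, z ^+ 6 = 1}.
  by move=> z; rewrite !inE => /or4P[] /eqP->; ring: w2.
have uzs : uniq zs.
  have nN (a : F) : a != 0 -> a != - a by move=> a0; rewrite -addr_eq0 -mulr2n mulrn_eq0.
  have ww : w != w ^+ 2.
    by rewrite -subr_eq0 -{1}[w]mulr1 expr2 -mulrBr mulf_neq0 // subr_eq0 eq_sym.
  have wNw : w != - w ^+ 2.
    rewrite -addr_eq0 w2 (_ : w + (- w - 1) = -1) ?oppr_eq0 ?oner_eq0 //; ring.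
  by rewrite /= !inE !negb_or nN // ww wNw eqr_oppLR wNw eqr_opp ww nN // expf_neq0.
have Xls l : l \in ls -> X l != 0 by move=> lls; apply: X0; rewrite inE lls orbT.
have urs : uniq rs.
  apply/andP; split.
    apply/negP => /allpairsP[[l z] /= [lls zz /esym/eqP]].
    by rewrite mulf_eq0 (negPf (zs0 _ zz)) (negPf (Xls _ lls)).
  apply: allpairs_uniq => // a b Ha Hb.
  move/allpairsP: Ha => [[l z] /= [lls zz ->]].
  move/allpairsP: Hb => [[l' z'] /= [lls' zz' ->]] /= E.
  have ll : l = l'.
    have /(congr1 (fun y => y ^+ 6)) := E; rewrite !exprMn (zs6 _ zz) (zs6 _ zz') !mul1r.
    by apply: inj; rewrite inE ?lls ?lls' orbT.
  by move: E; rewrite -ll => /(mulIf (Xls _ lls)) ->.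
have f_poly : polyfun (4 * (2 * m).+1) f.
  apply: polyfunB.
    have -> : (4 * (2 * m).+1 = 4 * size ls + 0)%N by rewrite sls addn0.
    apply: polyfunM; last exact: polyfun_cst.
    by apply: polyfun_qtZ_setX; rewrite /= l1ls.
  apply: (@polyfunW _ (0 + (1 + (3 * (2 * m) + 2 * (m + 1))))); first by lia.
  apply: polyfunM; first exact: polyfun_cst.
  apply: polyfunM; first exact: polyfun_id.
  apply: polyfunM.
    apply: polyfunX; apply: polyfun_sqr; apply: polyfunW pq1; rewrite sS; lia.
  by apply: polyfun_sqr; apply: polyfunW pq2; rewrite sS; lia.
have f_rs : {in rs, forall t, f t = 0}.
  move=> t; rewrite inE => /orP[/eqP->|].
    (* At [t = 0] line [l1] has no crossings of type c, and the other term contains the factor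
       [t]. *)
    rewrite /f mul0r mulr0 subr0 qtZ_nocross ?mul0r // /lwgt ?eqxx //.
      move=> c cls; rewrite XX1; case: eqP => [E|_ /=]; first by rewrite E cls in l1ls.
      by rewrite mulr0 mul0r.
    move=> c cls; rewrite XX1; case: eqP => [E|_ /=]; first by rewrite -E cls in l1ls.
    by rewrite mulr0.
  case/allpairsP => [[l z] /= [lls zz ->]] {t}; set t := z * X l.
  have t0 : t != 0 by rewrite /t mulf_neq0 ?(zs0 _ zz) ?Xls.
  apply/fE.
    move=> y /mapP[c cls ->]; apply/eqP => E.
    have cl : c = l.
      apply: inj; rewrite ?inE ?lls ?cls ?orbT //.
      have := congr1 (fun y => y ^+ 3) E; rewrite /= -!exprM => <-.
      by rewrite /t exprMn (zs6 _ zz) mul1r.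
    move/eqP: E; rewrite cl /t exprMn -subr_eq0 -{2}[X l ^+ 2]mul1r -mulrBl mulf_eq0.
    rewrite expf_eq0 /= (negPf (Xls _ lls)) orbF subr_eq0.
    by case/orP: (zs2 _ zz) => /eqP->; rewrite ?(negPf w21) ?(negPf w_neq1).
  have nz : {in l1 :: ls, forall c, setX X l1 t c != 0}.
    move=> c; rewrite inE => /orP[/eqP->|cls]; first by rewrite XX1.
    by rewrite XXl // Xls.
  have l1l : l1 != l by apply: contraNneq l1ls => ->.
  have [p [q Els]] : exists p q, ls = p ++ l :: q.
    by case/splitPr: lls => p q; exists p, q.
  have ulq : uniq ([:: l1] ++ p ++ l :: q) by rewrite -Els /= l1ls.
  have pls : perm_eq ls (l :: p ++ q) by rewrite Els -cat1s perm_catCA.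
  have ulpq : uniq (l :: p ++ q) by rewrite -(perm_uniq pls).
  have sub : {subset p ++ q <= ls}.
    by move=> c cpq; rewrite (perm_mem pls) inE cpq orbT.
  have u2 : uniq [:: l1, l & p ++ q] by move: l1ls; rewrite (perm_mem pls) /= => ->.
  have IH : qtZ_formula (setX X l1 t) (p ++ q) m.
    apply: IHm; first by case/andP: ulpq.
    - by move: sls; rewrite (perm_size pls) => -[].
    - by move=> c /sub cls; apply: nz; rewrite inE cls orbT.
    - move=> a b /sub als /sub bls; rewrite !XXl //.
      by apply: inj; rewrite inE ?als ?bls orbT.
  have Xt := XXl t _ lls; have X1 := XX1 t.
  have w3 := w3 w2.
  have moveZ : qtZ (lwgt w (setX X l1 t)) [:: l1, l & p ++ q] =
     qtZ (lwgt w (setX X l1 t)) (l1 :: ls).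
    rewrite [in RHS]Els; apply/esym/(@qtZ_move _ _ w2 w_neq1 _ _ [:: l1]) => //=.
    by rewrite -Els.
  have spq : size (p ++ q) = (2 * m)%N by move: sls; rewrite (perm_size pls) => -[].
  (* If [z ^+ 2 = w ^+ 2], then [X l ^+ 2 = w * t ^+ 2] and [l1] must come first. If [z ^+ 2 = w],
     then [t ^+ 2 = w * X l ^+ 2] and [l] must come first. *)
  case/orP: (zs2 _ zz) => /eqP z2.
    apply: (@qtZ_formula_perm _ [:: l1, l & p ++ q]) => //.
      by rewrite perm_cons perm_sym.
    apply: qtZ_formula_step => //.
    by rewrite Xt X1 /t exprMn z2 mulrA -exprS w3 mul1r.
  apply: (@qtZ_formula_perm _ [:: l, l1 & p ++ q]) => //.
  - apply: (@perm_trans _ [:: l1, l & p ++ q]); last by rewrite perm_cons perm_sym.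
    exact/permEl/(perm_catCA [:: l] [:: l1]).
  - rewrite -moveZ; apply: (@qtZ_swap_adj _ _ w2 w_neq1 _ _ [::]) => //.
      by rewrite X1.
    by rewrite Xt Xls.
  apply: qtZ_formula_step => //.
    move: u2; rewrite /= !inE !negb_or eq_sym.
    by case/andP=> /andP[-> ->] /andP[-> ->].
  by rewrite Xt X1 /t exprMn z2.
have srs : (4 * (2 * m).+1 < size rs)%N.
  have -> : size rs = (size [seq z * X l | l <- ls, z <- zs]).+1 by [].
  by rewrite size_allpairs sls mulnC.
apply: (@eq_qtZ_formula (setX X l1 (X l1))).
  by move=> l; rewrite /setX; case: eqP => [->|].
apply/fE; last exact: polyfun_eq0 f_poly urs srs f_rs _.
move=> y /mapP[c cls ->]; apply/eqP => E; case/negP: l1ls.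
suff -> : l1 = c by [].
apply: inj; rewrite ?inE ?eqxx ?cls ?orbT //.
by have := congr1 (fun y => y ^+ 3) E; rewrite /= -!exprM.
Qed.

End PartitionFunction.

(** * Specialization to geometric sequences *)

Lemma exp01_homo : {homo exp01 : i j / (i < j)%N}.
Proof. by move=> i j ij; rewrite /exp01; lia. Qed.

Lemma exp02_homo : {homo exp02 : i j / (i < j)%N}.
Proof. by move=> i j ij; rewrite /exp02; lia. Qed.

Definition vdm (e : nat -> nat) n := (\prod_(i < n) \prod_(j < n | i < j) (e j - e i))%N.

Lemma vdm_gt0 e n : {homo e : i j / (i < j)%N} -> (0 < vdm e n)%N.
Proof.
move=> he; apply: prodn_gt0 => i; apply: prodn_cond_gt0 => j ij.
by rewrite subn_gt0 he.
Qed.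

Section Specialization.
Variables (F : numFieldType) (w : F).
Hypotheses (w2 : w ^+ 2 = - w - 1) (w_neq1 : w != 1).

Definition pfun (f : F -> F) := exists d, polyfun d f.

Lemma pfun_cst c : pfun (fun=> c).
Proof. by exists 0%N; apply: polyfun_cst. Qed.

Lemma pfunX i : pfun (fun t => t ^+ i).
Proof. by exists (i * 1)%N; apply: polyfunX; apply: polyfun_id. Qed.

Lemma pfunM f g : pfun f -> pfun g -> pfun (fun t => f t * g t).
Proof. by move=> [d pf] [e pg]; exists (d + e)%N; apply: polyfunM. Qed.

Lemma pfunXn f n : pfun f -> pfun (fun t => f t ^+ n).
Proof. by move=> [d pf]; exists (n * d)%N; apply: polyfunX. Qed.

Lemma pfunD f g : pfun f -> pfun g -> pfun (fun t => f t + g t).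
Proof.
move=> [d pf] [e pg]; exists (maxn d e); apply: polyfunD.
  by apply: polyfunW pf; apply: leq_maxl.
by apply: polyfunW pg; apply: leq_maxr.
Qed.

Lemma pfunN f : pfun f -> pfun (fun t => - f t).
Proof.
move=> pf; have [d H] := pfunM (pfun_cst (-1)) pf.
by exists d; apply: polyfun_ext H => t; rewrite mulN1r.
Qed.

Lemma pfun_ext f g : f =1 g -> pfun f -> pfun g.
Proof. by move=> fg [d pf]; exists d; apply: polyfun_ext pf. Qed.

Lemma pfun_sum (I : Type) (r : seq I) (P : pred I) (f : I -> F -> F) :
  (forall i, pfun (f i)) -> pfun (fun t => \sum_(i <- r | P i) f i t).
Proof.
move=> pf; elim: r => [|i r IHr].
  by apply: pfun_ext (pfun_cst 0) => t; rewrite big_nil.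
case Pi : (P i); last by apply: pfun_ext IHr => t; rewrite big_cons Pi.
by apply: pfun_ext (pfunD (pf i) IHr) => t; rewrite big_cons Pi.
Qed.

Lemma pfun_prod (I : Type) (r : seq I) (P : pred I) (f : I -> F -> F) :
  (forall i, pfun (f i)) -> pfun (fun t => \prod_(i <- r | P i) f i t).
Proof.
move=> pf; elim: r => [|i r IHr].
  by apply: pfun_ext (pfun_cst 1) => t; rewrite big_nil.
case Pi : (P i); last by apply: pfun_ext IHr => t; rewrite big_cons Pi.
by apply: pfun_ext (pfunM (pf i) IHr) => t; rewrite big_cons Pi.
Qed.

(** Arguments 0 and 1 are left out because the powers of [s] must be nonzero and distinct when
    [qtZ_formula_generic] is applied. *)
Lemma pfun_eq f g : pfun f -> pfun g ->
  (forall s : nat, (1 < s)%N -> f s%:R = g s%:R) -> f =1 g.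
Proof.
move=> pf pg fg; have [d pfg] := pfunD pf (pfunN pg).
pose rs : seq F := [seq i%:R | i <- iota 2 d.+1].
move=> t; apply/eqP; rewrite -subr_eq0; apply/eqP.
apply: (polyfun_eq0 (rs := rs)) pfg _ _ _ t => //.
- by rewrite map_inj_uniq ?iota_uniq // => i j /eqP; rewrite eqr_nat => /eqP.
- by rewrite size_map size_iota.
- by move=> _ /mapP[i + ->]; rewrite mem_iota => /andP[i2 _]; rewrite fg // subrr.
Qed.

(* The alternant at (t^i)_i divided by the appropriate power of t - 1. *)
Definition qvdm (e : nat -> nat) n (t : F) :=
  \prod_(i < n) \prod_(j < n | (i < j)%N) (t ^+ e i * \sum_(k < e j - e i) t ^+ k).

Lemma pfun_qvdm e n : pfun (qvdm e n).
Proof.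
by apply: pfun_prod => i; apply: pfun_prod => j; apply: pfunM;
  [apply: pfunX | apply: pfun_sum => k; apply: pfunX].
Qed.

Lemma qvdm1 e n : qvdm e n 1 = (vdm e n)%:R.
Proof.
rewrite /qvdm /vdm natr_prod; apply: eq_bigr => i _.
rewrite natr_prod; apply: eq_bigr => j _.
rewrite expr1n mul1r; under eq_bigr do rewrite expr1n.
by rewrite sumr_const card_ord.
Qed.

Lemma alt_qvdm e n t : {homo e : i j / (i < j)%N} ->
  alt e [seq t ^+ i | i <- iota 0 n] =
  (\prod_(i < n) \prod_(j < n | (i < j)%N) (t - 1)) * qvdm e n t.
Proof.
move=> he; rewrite alt_geom -big_split /=; apply: eq_bigr => i _.
rewrite -big_split /=; apply: eq_bigr => j ij.
rewrite mulrCA -subrX1 mulrBr mulr1 -exprD subnKC //.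
exact/ltnW/he.
Qed.

Definition qtZ1 n : F := qtZ (fun _ _ : nat => (1, 1, 1)) (iota 0 n).

(** Each of the [n * n.-1] crossings of distinct lines has all three weights equal to [w - 1]. *)
Lemma qtZ_at1 n : qtZ (lwgt w (fun=> 1)) (iota 0 n) = (w - 1) ^+ (n * n.-1) * qtZ1 n.
Proof.
pose s (l l' : nat) : F := if l == l' then 1 else w - 1.
rewrite (@eq_qtZ _ _ _ (fun l l' => wscale (s l l') (1, 1, 1))); last first.
  move=> l l'; rewrite /lwgt /s /wgt /wscale /=.
  by case: eqP => _; rewrite ?expr1n !mulr1.
rewrite qtZ_scale; congr (_ * _).
rewrite (eq_big_seq (fun=> (w - 1) ^+ n.-1)); last first.
  move=> r rn; rewrite (bigD1_seq r) ?iota_uniq //= {1}/s eqxx mul1r.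
  rewrite (eq_bigr (fun=> w - 1)); last by move=> c; rewrite /s eq_sym => /negPf->.
  rewrite big_const_seq iter_mulr_1; congr (_ ^+ _).
  have := count_predC (pred1 r) (iota 0 n).
  by rewrite count_uniq_mem ?iota_uniq // rn size_iota add1n => /(congr1 predn).
by rewrite big_const_seq count_predT size_iota iter_mulr_1 -exprM mulnC.
Qed.

(** At [X l = s ^+ l] both sides contain the same power of [s ^+ 2 - 1]. It is cancelled for
    integers [s > 1], and polynomiality extends the result to [s = 1]. *)
Lemma qtZ1_formula m :
  qtZ1 (2 * m) * (\prod_(i < m) 81 ^ i * vdm id (2 * m) ^ 4)%N%:R
  = (vdm exp01 (2 * m) ^ 3 * vdm exp02 (2 * m))%N%:R.
Proof.
set n := (2 * m)%N.
pose f (s : F) := qtZ (lwgt w (fun l => s ^+ l)) (iota 0 n) * qvdm id n (s ^+ 2) ^+ 4.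
pose g (s : F) := qtZ_const w m * \prod_(l <- iota 0 n) s ^+ l *
    qvdm exp01 n (s ^+ 2) ^+ 3 * qvdm exp02 n (s ^+ 2).
have pq e : pfun (fun s => qvdm e n (s ^+ 2)).
  have [d pd] := pfun_qvdm e n; exists (2 * d)%N; exact: polyfun_sqr.
have pf : pfun f.
  apply: pfunM; last exact/pfunXn/pq.
  pose d (l l' : nat) := (2 * l + 2 * l')%N.
  exists (\sum_(r <- iota 0 n) \sum_(c <- iota 0 n) d r c)%N.
  apply: polyfun_qtZ => l l'; rewrite /lwgt.
  case: eqP => _; first by split; apply: polyfun_cst.
  have pX k : (k <= 2 * l + 2 * l')%N -> polyfun (d l l') (fun t : F => t ^+ k).
    by move=> kd; apply: (@polyfunW _ (k * 1)); [rewrite muln1 | apply/polyfunX/polyfun_id].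
  have pcX c k : (k <= 2 * l + 2 * l')%N -> polyfun (d l l') (fun t : F => c * t ^+ k).
    move=> kd; rewrite -[d l l']add0n; apply: polyfunM; first exact: polyfun_cst.
    exact: pX.
  split.
  - apply: polyfunB.
      by apply: polyfun_ext (pcX w (l * 2)%N _) => [t|]; rewrite ?exprM //; lia.
    by apply: polyfun_ext (pX (l' * 2)%N _) => [t|]; rewrite ?exprM //; lia.
  - apply: polyfunB.
      by apply: polyfun_ext (pcX w (l' * 2)%N _) => [t|]; rewrite ?exprM //; lia.
    by apply: polyfun_ext (pX (l * 2)%N _) => [t|]; rewrite ?exprM //; lia.
  - apply: polyfun_ext (pcX (w - 1) (l + l')%N _) => [t|]; last lia.
    by rewrite exprD mulrA.
have pg : pfun g.
  apply: pfunM; last exact: pq.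
  apply: pfunM; last exact/pfunXn/pq.
  apply: pfunM; first exact: pfun_cst.
  by apply: pfun_prod => l; apply: pfunX.
have fg s : (1 < s)%N -> f s%:R = g s%:R.
  move=> s1; have s0 : s%:R != 0 :> F by rewrite pnatr_eq0; lia.
  have H : qtZ_formula w (fun l => s%:R ^+ l) (iota 0 n) m.
    apply: qtZ_formula_generic; rewrite ?iota_uniq ?size_iota //.
      by move=> l _; rewrite expf_neq0.
    move=> i j _ _ /eqP; rewrite -!exprM -!natrX eqr_nat eqn_exp2l // eqn_pmul2r //.
    by move/eqP.
  move: H; rewrite /qtZ_formula.
  have -> : sqs (fun l => s%:R ^+ l) (iota 0 n) = [seq (s%:R ^+ 2 : F) ^+ i | i <- iota 0 n].
    by apply: eq_map => l; rewrite -!exprM mulnC.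
  rewrite !alt_qvdm //; [|exact: exp02_homo|exact: exp01_homo].
  set V := \prod_(i < n) _; have V0 : V ^+ 4 != 0.
    rewrite expf_neq0 //; apply/prodf_neq0 => i _; apply/prodf_neq0 => j _.
    by rewrite subr_eq0 -natrX pnatr_eq1; move: s1; case: (s) => [|[|?]].
  by move=> H; apply: (mulIf V0); rewrite /f /g; apply: etrans (etrans H _); ring.
have /(_ 1) := pfun_eq pf pg fg.
rewrite /f /g !expr1n !qvdm1.
rewrite (@eq_qtZ _ _ _ (lwgt w (fun=> 1))); last by move=> l l'; rewrite /lwgt !expr1n.
rewrite big1 => [|l _]; last by rewrite expr1n.
rewrite qtZ_at1.
(* The powers of 81 come from [(w - 1) ^+ 2 = - 3 * w], which gives [(w - 1) ^+ 8 = 81 * w ^+ 4]. *)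
have -> : (w - 1) ^+ (n * n.-1) = qtZ_const w m * (\prod_(i < m) 81 ^ i)%N%:R.
  rewrite /n; elim: m {n f g pq pf pg fg} => [|m IHm].
    by rewrite /qtZ_const !big_ord0 mulr1.
  rewrite /qtZ_const !big_ord_recr /= -/(qtZ_const w m) natrM.
  rewrite (_ : (2 * m.+1 * (2 * m.+1).-1)%N = (2 * m * (2 * m).-1 + (2 + 2 * (4 * m)))%N).
    rewrite exprD IHm exprD [(_ - _) ^+ (2 * (_ * _))]exprM.
    rewrite (_ : (w - 1) ^+ 2 ^+ (4 * m) = w ^+ (4 * m) * (81 ^ m)%:R); first ring.
    rewrite exprM (_ : (w - 1) ^+ 2 ^+ 4 = w ^+ 4 * 81%:R); last by ring: w2.
    by rewrite exprMn -exprM natrX.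
  by case: m {IHm} => // m; rewrite !mulnS; lia.
have C0 : qtZ_const w m != 0.
  apply/prodf_neq0 => i _; rewrite mulf_neq0 // expf_neq0 ?subr_eq0 //.
  exact: w_neq0 w2.
move=> H; apply: (mulfI C0).
rewrite 2!natrM !natrX; apply: etrans (etrans H _); ring.
Qed.

End Specialization.

(** * The product formula *)

Section ProductFormula.

Lemma vdm_recr e n : vdm e n.+1 = (vdm e n * \prod_(i < n) (e n - e i))%N.
Proof.
rewrite /vdm big_ord_recr /= [X in (_ * X)%N]big1 ?muln1; last first.
  by move=> j; rewrite ltnNge -ltnS ltn_ord.
rewrite -big_split /=; apply: eq_bigr => i _.
by rewrite big_mkcond big_ord_recr /= ltn_ord -big_mkcond.
Qed.

Lemma prod_pairs (g : nat -> nat) m :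
  (\prod_(i < 2 * m) g i = \prod_(k < m) (g (2 * k) * g (2 * k).+1))%N.
Proof.
elim: m => [|m IHm]; first by rewrite !big_ord0.
by rewrite mulnS !big_ord_recr /= IHm mulnA.
Qed.

Lemma vdm_step e m : vdm e (2 * m.+1) = (vdm e (2 * m) *
   (\prod_(k < m) ((e (2 * m) - e (2 * k)) * (e (2 * m) - e (2 * k).+1) *
      ((e (2 * m).+1 - e (2 * k)) * (e (2 * m).+1 - e (2 * k).+1)))
    * (e (2 * m).+1 - e (2 * m))))%N.
Proof.
rewrite (_ : (2 * m.+1)%N = (2 * m).+2); last by lia.
rewrite !vdm_recr big_ord_recr /=.
rewrite (prod_pairs (fun i => e (2 * m) - e i)%N).
rewrite (prod_pairs (fun i => e (2 * m).+1 - e i)%N).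
by rewrite [in RHS]big_split /= !mulnA.
Qed.

Lemma prod_rev (G : nat -> nat) m : (\prod_(k < m) G (m - k) = \prod_(k < m) G k.+1)%N.
Proof.
rewrite (reindex_inj rev_ord_inj) /=; apply: eq_bigr => k _.
by rewrite subKn.
Qed.

Lemma vdm_exp01 m :
  vdm exp01 (2 * m.+1) = (vdm exp01 (2 * m) * (3 ^ m * m`! * (3 * m).+1`!))%N.
Proof.
rewrite vdm_step; congr (_ * _)%N.
have E k : exp01 (2 * k) = (3 * k)%N by rewrite /exp01; lia.
have E' k : exp01 (2 * k).+1 = (3 * k).+1 by rewrite /exp01; lia.
(* The four differences depend on [i = m - k] alone. The consecutive numbers [3 * i - 1], [3 * i],
   [3 * i + 1] build up [(3 * m).+1]![, and the second]3 * i[gives]3 ^ m * m[!]. *)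
pose G i := (3 * i * (3 * i).-1 * ((3 * i).+1 * (3 * i)))%N.
rewrite (eq_bigr (fun k : 'I_m => G (m - k)%N)); last first.
  move=> k _; have := ltn_ord k; rewrite !E !E' /G => km.
  by congr (_ * _ * (_ * _))%N; lia.
rewrite prod_rev E E' subSnn muln1.
elim: m => [|m IHm]; first by rewrite big_ord0.
rewrite big_ord_recr /= IHm /G (_ : 3 * m.+1 = (3 * m).+3)%N; last by lia.
by rewrite !factS expnS; lia.
Qed.

Lemma vdm_exp02 m :
  vdm exp02 (2 * m.+1) =
  (vdm exp02 (2 * m) * (3 ^ m * m`! * ((3 * m).+2 * (3 * m)`!)))%N.
Proof.
rewrite vdm_step; congr (_ * _)%N.
have E k : exp02 (2 * k) = (3 * k)%N by rewrite /exp02; lia.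
have E' k : exp02 (2 * k).+1 = (3 * k).+2 by rewrite /exp02; lia.
pose G i := (3 * i * (3 * i).-2 * ((3 * i).+2 * (3 * i)))%N.
rewrite (eq_bigr (fun k : 'I_m => G (m - k)%N)); last first.
  move=> k _; have := ltn_ord k; rewrite !E !E' /G => km.
  by congr (_ * _ * (_ * _))%N; lia.
rewrite prod_rev E E' (_ : (3 * m).+2 - 3 * m = 2)%N; last by lia.
elim: m => [|m IHm]; first by rewrite big_ord0.
rewrite big_ord_recr /= mulnAC IHm /G (_ : 3 * m.+1 = (3 * m).+3)%N; last by lia.
by rewrite !factS expnS; lia.
Qed.

Lemma vdm_id m : vdm id (2 * m.+1) = (vdm id (2 * m) * ((2 * m)`! * (2 * m).+1`!))%N.
Proof.
rewrite (_ : (2 * m.+1)%N = (2 * m).+2); last by lia.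
have F n : (\prod_(i < n) (n - i) = n`!)%N.
  by rewrite (prod_rev id) /= fact_prod big_add1 big_mkord.
by rewrite !vdm_recr !F mulnA.
Qed.

(* The number of m x m alternating sign matrices. *)
Definition asmA m : rat := \prod_(0 <= k < m) ((3 * k + 1)`!%:R / (m + k)`!%:R).

(* The number of cyclically symmetric plane partitions in an m-cube. *)
Definition cspp m : rat := \prod_(1 <= i < m.+1)
  ((3 * i%:R - 1) / (3 * i%:R - 2) *
   \prod_(i <= j < m.+1) ((m%:R + i%:R + j%:R - 1) / (2 * i%:R + j%:R - 1))).

Lemma factr_neq0 n : n`!%:R != 0 :> rat.
Proof. by rewrite pnatr_eq0 -lt0n fact_gt0. Qed.

Lemma asmA_step m : asmA m.+1 * ((2 * m)`!%:R * (2 * m).+1`!%:R)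
  = asmA m * (m`!%:R * (3 * m).+1`!%:R).
Proof.
pose N m := \prod_(0 <= k < m) ((3 * k + 1)`!%:R : rat).
pose D m := \prod_(0 <= k < m) ((m + k)`!%:R : rat).
have AE n : asmA n = N n / D n by rewrite /asmA prodf_div.
have D0 n : D n != 0.
  by rewrite prodf_seq_neq0; apply/allP => i _; rewrite factr_neq0.
have DS : D m.+1 * m`!%:R = D m * ((2 * m)`!%:R * (2 * m).+1`!%:R).
  transitivity (\prod_(0 <= k < m.+2) ((m + k)`!%:R : rat)).
    rewrite big_nat_recl //= addn0 mulrC; congr (_ * _).
    by apply: eq_bigr => k _; rewrite addnS.
  by rewrite !big_nat_recr //= -mulrA addnS addnn -mul2n.
have NS : N m.+1 = N m * (3 * m).+1`!%:R by rewrite /N big_nat_recr //= addn1.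
rewrite !AE NS.
have f0 := factr_neq0 m.
have -> : (2 * m)`!%:R * (2 * m).+1`!%:R = D m.+1 * m`!%:R / D m.
  by rewrite DS mulrAC mulfV ?mul1r.
by field; rewrite !D0.
Qed.

Lemma prod_rising a k :
  \prod_(1 <= i < k.+1) (a%:R + i%:R) * a`!%:R = (a + k)`!%:R :> rat.
Proof.
elim: k => [|k IHk]; first by rewrite big_geq // mul1r addn0.
rewrite big_nat_recr //= mulrAC IHk addnS factS natrM -natrD addnS mulrC //.
Qed.

Lemma prod_rising2 a k :
  \prod_(1 <= i < k.+1) ((a%:R + 2 * i%:R - 1) * (a%:R + 2 * i%:R)) * a`!%:R
  = (a + 2 * k)`!%:R :> rat.
Proof.
elim: k => [|k IHk]; first by rewrite big_geq // mul1r addn0.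
rewrite big_nat_recr //= mulrAC IHk (_ : (a + 2 * k.+1 = (a + 2 * k).+2)%N); last by lia.
rewrite !factS !natrM -!natr1 natrD natrM; ring.
Qed.

Definition cspp_factor m i : rat := (3 * i%:R - 1) / (3 * i%:R - 2) *
   \prod_(i <= j < m.+1) ((m%:R + i%:R + j%:R - 1) / (2 * i%:R + j%:R - 1)).

Lemma cspp_factor_step m i : (1 <= i <= m)%N -> cspp_factor m.+1 i = cspp_factor m i *
   (((2 * m)%:R + i%:R) * ((2 * m).+1%:R + i%:R) /
    ((m%:R + 2 * i%:R - 1) * (m%:R + 2 * i%:R))).
Proof.
move=> /andP[i1 im]; rewrite /cspp_factor -[RHS]mulrA; congr (_ * _).
have i1R : 1 <= i%:R :> rat by rewrite ler1n.
have m0R : 0 <= m%:R :> rat by rewrite ler0n.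
(* The numerators are consecutive integers. Passing from [m] to [m.+1] drops the first of them and
   adds two at the end. *)
have EN : \prod_(i <= j < m.+2) (m.+1%:R + i%:R + j%:R - 1) * (m%:R + 2 * i%:R - 1)
    = \prod_(i <= j < m.+1) (m%:R + i%:R + j%:R - 1) *
      (((2 * m)%:R + i%:R) * ((2 * m).+1%:R + i%:R)) :> rat.
  transitivity (\prod_(i <= j < m.+3) (m%:R + i%:R + j%:R - 1) : rat).
    rewrite [RHS]big_ltn ?big_add1 /=; last by lia.
    rewrite mulrC; congr (_ * _); first by ring.
    by apply: eq_bigr => j _; rewrite -!natr1; ring.
  rewrite big_nat_recr /=; last by lia.
  rewrite big_nat_recr /=; last by lia.
  rewrite -mulrA; congr (_ * _); rewrite -!natr1 !natrM; ring.
have n1 : m%:R + 2 * i%:R - 1 != 0 :> rat by apply: lt0r_neq0; lra.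
have n2 : m%:R + 2 * i%:R != 0 :> rat by apply: lt0r_neq0; lra.
have ED : \prod_(i <= j < m.+2) (2 * i%:R + j%:R - 1)
    = \prod_(i <= j < m.+1) (2 * i%:R + j%:R - 1) * (2 * i%:R + m.+1%:R - 1) :> rat.
  by rewrite big_nat_recr //=; lia.
rewrite !prodf_div ED.
set Nm := \prod_(i <= j < m.+2) _ in EN *; set N := \prod_(i <= j < m.+1) _ in EN *.
set D := \prod_(i <= j < m.+1) (2 * i%:R + j%:R - 1).
have D0 : D != 0.
  rewrite prodf_seq_neq0; apply/allP => j _ /=; apply: lt0r_neq0.
  have : 0 <= j%:R :> rat by rewrite ler0n.
  lra.
have -> : Nm = N * (((2 * m)%:R + i%:R) * ((2 * m).+1%:R + i%:R)) / (m%:R + 2 * i%:R - 1).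
  by rewrite -EN mulfK.
by rewrite -!natr1 natrM; field; rewrite D0 n1 n2.
Qed.

(** Over all [i <= m] the ratios of [cspp_factor_step] multiply to rising factorials, which become
    quotients of factorials; the new index [m.+1] adds one more factor. *)
Lemma cspp_step m : cspp m.+1 * ((2 * m)`!%:R * (2 * m).+1`!%:R)
  = cspp m * (m`!%:R * ((3 * m).+2%:R * (3 * m)`!%:R)).
Proof.
have E n : cspp n = \prod_(1 <= i < n.+1) cspp_factor n i by [].
rewrite !E big_nat_recr //=.
have U1 := prod_rising (2 * m) m.
have U2 := prod_rising (2 * m).+1 m.
have U3 := prod_rising2 m m.
rewrite (_ : 2 * m + m = 3 * m)%N in U1; last by lia.
rewrite (_ : (2 * m).+1 + m = (3 * m).+1)%N in U2; last by lia.
rewrite (_ : m + 2 * m = 3 * m)%N in U3; last by lia.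
set u1 := \prod_(1 <= i < _) (_%:R + i%:R) in U1.
set u2 := \prod_(1 <= i < _) (_%:R + i%:R) in U2.
set u3 := \prod_(1 <= i < _) (_ * _) in U3.
set c := \prod_(1 <= i < m.+1) cspp_factor m i.
have -> : \prod_(1 <= i < m.+1) cspp_factor m.+1 i = c * (u1 * u2 / u3).
  rewrite /c /u1 /u2 /u3 -[in RHS]big_split -prodf_div -big_split /=.
  by apply: eq_big_nat => i im; apply: cspp_factor_step.
have -> : cspp_factor m.+1 m.+1 = (3 * m).+2%:R / (3 * m).+1%:R.
  rewrite /cspp_factor big_nat1 -!natr1 !natrM.
  have m0R : 0 <= m%:R :> rat by rewrite ler0n.
  by field; apply/andP; split; apply: lt0r_neq0; lra.
have u30 : u3 != 0.
  by apply: contra_eq_neq U3 => ->; rewrite mul0r eq_sym factr_neq0.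
have q0 : (3 * m).+1%:R != 0 :> rat by rewrite pnatr_eq0.
rewrite (factS (3 * m)) natrM in U2; set q := (3 * m).+1%:R in q0 U2 *; set r := (3 * m).+2%:R.
clearbody q r.
transitivity (c * (u1 * (2 * m)`!%:R) * (u2 * (2 * m).+1`!%:R) / u3 * (r / q)).
  by field; rewrite u30 q0.
by rewrite U1 U2 -U3; field; rewrite u30 q0.
Qed.

(** Both sides satisfy the same recursion in [m]. *)
Lemma vdm_asmA m : (vdm exp01 (2 * m))%:R =
  (\prod_(i < m) 3 ^ i)%N%:R * asmA m * (vdm id (2 * m))%:R.
Proof.
elim: m => [|m IHm]; first by rewrite /vdm /asmA !big_ord0 big_geq // !mulr1.
rewrite vdm_exp01 vdm_id big_ord_recr /=.
move: (asmA_step m).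
move: (m`!) ((3 * m).+1`!) ((2 * m)`!) ((2 * m).+1`!) (3 ^ m)%N => f1 f2 f3 f4 c step.
rewrite !natrM IHm; apply: esym.
transitivity ((\prod_(i < m) 3 ^ i)%:R * c%:R * (asmA m.+1 * (f3%:R * f4%:R)) *
  (vdm id (2 * m))%:R); first by ring.
rewrite step; ring.
Qed.

Lemma vdm_cspp m : (vdm exp02 (2 * m))%:R =
  (\prod_(i < m) 3 ^ i)%N%:R * cspp m * (vdm id (2 * m))%:R.
Proof.
elim: m => [|m IHm]; first by rewrite /vdm /cspp !big_ord0 big_geq // !mulr1.
rewrite vdm_exp02 vdm_id big_ord_recr /=.
move: (cspp_step m).
move: (m`!) ((3 * m)`!) ((2 * m)`!) ((2 * m).+1`!) (3 ^ m)%N => f1 f2 f3 f4 c step.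
rewrite !natrM IHm; apply: esym.
transitivity ((\prod_(i < m) 3 ^ i)%:R * c%:R * (cspp m.+1 * (f3%:R * f4%:R)) *
  (vdm id (2 * m))%:R); first by ring.
rewrite step; ring.
Qed.

(** The four alternants yield four equal powers of 3 and four factors [vdm id], which cancel against
    [81 = 3 ^ 4] and the fourth power on the left. *)
Lemma count_formula m N :
  (N * (\prod_(i < m) 81 ^ i * vdm id (2 * m) ^ 4) =
   vdm exp01 (2 * m) ^ 3 * vdm exp02 (2 * m))%N -> N%:R = asmA m ^+ 3 * cspp m.
Proof.
move/(congr1 (fun n => n%:R : rat)); rewrite 3!natrM !natrX vdm_asmA vdm_cspp => H.
have V0 : (vdm id (2 * m))%:R != 0 :> rat.
  rewrite pnatr_eq0 -lt0n; apply: prodn_gt0 => i.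
  by apply: prodn_cond_gt0 => j; rewrite subn_gt0.
have c0 : (\prod_(i < m) 3 ^ i)%N%:R != 0 :> rat.
  by rewrite pnatr_eq0 -lt0n; apply: prodn_gt0 => i; rewrite expn_gt0.
have c4 : (\prod_(i < m) 81 ^ i)%N%:R = (\prod_(i < m) 3 ^ i)%N%:R ^+ 4 :> rat.
  rewrite -natrX; congr (_%:R); elim: m {N H V0 c0} => [|m IHm].
    by rewrite !big_ord0.
  by rewrite !big_ord_recr /= IHm expnMn; congr (_ * _)%N; rewrite -expnM mulnC expnM.
move: H; rewrite c4; set c := _%:R in c0 *; set V := _%:R in V0 *; move=> H.
have cV0 : c ^+ 4 * V ^+ 4 != 0 by rewrite mulf_neq0 ?expf_neq0.
apply: (mulIf cV0); rewrite H; ring.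
Qed.

End ProductFormula.

(** * Matrices as configurations *)

Section Counting.
Variable R : numFieldType.

Let u1 (l l' : nat) : R * R * R := (1, 1, 1).
Definition bz (b : bool) : int := (b : nat)%:Z.

(** The partial sums are the successive states of a line that starts in [h] and ends in [k]. *)
Fixpoint prefix01 (h : int) (l : seq int) (k : int) : bool :=
  if l is e :: l' then (h + e \in [:: 0; 1]) && prefix01 (h + e) l' k else h == k.

(** Columns are summed downwards, so the state below an entry is the state above it plus the
    entry. *)
Fixpoint addcol (wi : seq bool) (a : seq int) (wo : seq bool) : bool :=
  match wi, a, wo with
  | p :: wi', e :: a', q :: wo' => (bz p == bz q + e) && addcol wi' a' wo'
  | [::], [::], [::] => true
  | _, _, _ => false
  end.

Definition entv (e : asm_entry) : int := ssval e.

Lemma mem01P (z : int) : reflect (exists b, z = bz b) (z \in [:: 0; 1]).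
Proof.
rewrite !inE; apply: (iffP orP) => [[] /eqP->|[[] ->]]; last by left.
- by exists false.
- by exists true.
- by right.
Qed.

Lemma bz_inj : injective bz.
Proof. by move=> [] []. Qed.

Lemma sum_entry (z : int) :
  \sum_(e : asm_entry) ((entv e == z)%:R : R) = (z \in [:: -1; 0; 1 : int])%:R.
Proof.
case: (boolP (z \in _)) => zin.
  rewrite (bigD1 (SeqSub zin)) //= /entv /= eqxx big1 ?addr0 // => e ez.
  by rewrite (_ : (_ == _) = false) //; apply: contraNF ez => /eqP E; apply/eqP/val_inj.
rewrite big1 // => e _; case: eqP => // E; case/negP: zin.
by rewrite -E; apply: (ssvalP e).
Qed.

(** The entry is determined as the change of the horizontal state; the conservation law says that
    the vertical state changes by the same amount. *)
Lemma vtx1_entry h p u q :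
  vtx (1, 1, 1) h p u q =
  \sum_(e : asm_entry) (((bz u == bz h + entv e) && (bz p == bz q + entv e))%:R : R).
Proof.
transitivity (\sum_(e : asm_entry) ((entv e == bz u - bz h)%:R *
    (bz u - bz h == bz p - bz q)%:R : R)).
  by rewrite -mulr_suml sum_entry; case: h; case: p; case: u; case: q;
    rewrite /vtx /bz /= ?mul0r ?mulr0 ?mul1r.
apply: eq_bigr => e _; rewrite -natrM mulnb; congr ((nat_of_bool _)%:R).
by apply/andP/andP => -[/eqP E1 /eqP E2]; split; apply/eqP; lia.
Qed.

Lemma row1_count l cs h wi wo k :
  row u1 l cs h wi wo k =
  \sum_(a : (size cs).-tuple asm_entry)
    ((prefix01 (bz h) (map entv a) (bz k) && addcol wi (map entv a) wo)%:R : R).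
Proof.
elim: cs h wi wo => [|c cs IHcs] h wi wo.
  rewrite (@sum_tuple0 _ _ (fun a => ((prefix01 (bz h) (map entv a) (bz k) &&
    addcol wi (map entv a) wo)%:R : R))) /=.
  by case: wi wo => [|p wi] [|q wo]; rewrite /= ?andbF // andbT (inj_eq bz_inj).
rewrite (@sum_tupleS _ _ _ (fun a => ((prefix01 (bz h) (map entv a) (bz k) &&
    addcol wi (map entv a) wo)%:R : R))).
case: wi wo => [|p wi] [|q wo];
  try by rewrite /= big1 // => e _; rewrite big1 // => a _; rewrite andbF.
rewrite [LHS]/=.
under eq_bigr do rewrite vtx1_entry mulr_suml.
rewrite exchange_big; apply: eq_bigr => e _.
transitivity (\sum_(a : (size cs).-tuple asm_entry) \sum_(u : bool)
   (((bz u == bz h + entv e) && (bz p == bz q + entv e))%:R *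
    (prefix01 (bz u) (map entv a) (bz k) && addcol wi (map entv a) wo)%:R : R)).
  rewrite exchange_big; apply: eq_bigr => u _.
  by rewrite IHcs mulr_sumr.
apply: eq_bigr => a _ /=.
case: (mem01P (bz h + entv e)) => [[b E]|nE].
  rewrite E (bigD1 b) //= eqxx big1 ?addr0.
    by rewrite -natrM mulnb andbCA.
  by move=> u ub; rewrite (inj_eq bz_inj) (negPf ub) mul0r.
rewrite big1 // => u _; case: eqP => [E|_]; last by rewrite mul0r.
by case: nE; exists u.
Qed.

Lemma addcolP n (wi wo : n.-tuple bool) (a : n.-tuple asm_entry) :
  addcol wi (map entv a) wo =
  [forall j : 'I_n, bz (tnth wi j) == bz (tnth wo j) + entv (tnth a j)].
Proof.
elim: n wi wo a => [|n IHn] wi wo a.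
  by rewrite (tuple0 wi) (tuple0 wo) (tuple0 a) /=; apply/esym/forallP => -[].
case/tupleP: wi => p wi; case/tupleP: wo => q wo; case/tupleP: a => e a /=.
rewrite IHn; apply/andP/forallP => [[H1 /forallP H2] j|H].
  by case: (unliftP ord0 j) => [i ->|->]; rewrite ?tnthS ?tnth0.
split; first by have := H ord0; rewrite !tnth0.
by apply/forallP => i; have := H (lift ord0 i); rewrite !tnthS.
Qed.

Definition rows_ok n hi ho (M : seq (n.-tuple asm_entry)) :=
  all (fun x : bool * bool * n.-tuple asm_entry =>
         prefix01 (bz x.1.1) (map entv x.2) (bz x.1.2)) (zip (zip hi ho) M).

Definition cols_ok n (wi wo : n.-tuple bool) (M : seq (n.-tuple asm_entry)) :=
  [forall j : 'I_n, prefix01 (bz (tnth wo j)) [seq entv (tnth a j) | a <- M]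
    (bz (tnth wi j))].

Lemma grid1_count n cs rs hi ho (wi wo : n.-tuple bool) : size cs = n ->
  size hi = size rs -> size ho = size rs ->
  grid u1 rs cs hi ho wi wo =
  \sum_(M : (size rs).-tuple (n.-tuple asm_entry))
    ((rows_ok hi ho M && cols_ok wi wo M)%:R : R).
Proof.
move=> scs; subst n; set n := size cs.
elim: rs hi ho wo => [|r rs IHrs] [|h hi] [|k ho] wo //=.
  move=> _ _; rewrite (@sum_tuple0 _ _ (fun M =>
    ((rows_ok [::] [::] M && cols_ok wi wo M)%:R : R))) /=.
  congr ((nat_of_bool _)%:R); apply/eqP/forallP => [/val_inj-> j|H]; first exact: eqxx.
  by apply: (congr1 val); apply: eq_from_tnth => j; apply/esym/bz_inj/eqP; exact: H.
move=> [shi] [sho].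
rewrite (@sum_tupleS _ _ _ (fun M => ((rows_ok (h :: hi) (k :: ho) M && cols_ok wi wo M)%:R : R))).
under eq_bigr do rewrite row1_count (IHrs _ _ _ shi sho) mulr_suml.
rewrite exchange_big; apply: eq_bigr => a _.
under eq_bigr do rewrite mulr_sumr.
rewrite exchange_big; apply: eq_bigr => M _; rewrite /rows_ok /cols_ok /=.
set A := all _ _; set p := prefix01 (bz h) _ _.
(* The states below the first row are forced to be those above it plus the entries, and they exist
   exactly when all these sums are 0 or 1. *)
case: (boolP [forall j : 'I_n, bz (tnth wo j) + entv (tnth a j) \in [:: 0; 1]]) => H.
  have /fin_all_exists[v Ev] : forall j : 'I_n, exists b, bz (tnth wo j) + entv (tnth a j) = bz b.
    by move=> j; apply/mem01P; move/forallP: H.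
  rewrite (bigD1 [tuple v j | j < n]) // big1 ?addr0.
    rewrite [LHS]addr0 addcolP -natrM mulnb; congr ((nat_of_bool _)%:R).
    rewrite -!andbA; congr (_ && _).
    have -> /= : [forall j, bz (tnth [tuple v j | j < n] j) == bz (tnth wo j) + entv (tnth a j)].
      by apply/forallP => j; rewrite tnth_mktuple Ev.
    congr (_ && _); apply: eq_forallb => j.
    by rewrite tnth_mktuple (forallP H) -Ev.
  move=> w wv; rewrite addcolP (_ : [forall j, _] = false) ?andbF ?mul0r //.
  apply: contraNF wv => /forallP H'; apply/eqP/eq_from_tnth => j.
  by rewrite tnth_mktuple; apply/bz_inj; rewrite -Ev; apply/eqP.
rewrite big1.
  rewrite [X in _ && X](_ : _ = false) ?andbF //.
  apply: contraNF H => /forallP H; by apply/forallP => j; case/andP: (H j).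
move=> w _; rewrite addcolP [X in _ && X](_ : _ = false) ?andbF ?mul0r //.
apply: contraNF H => /forallP H; apply/forallP => j.
by rewrite -(eqP (H j)); apply/mem01P; exists (tnth w j).
Qed.

Lemma prefix01E h l k : prefix01 h l k =
  [forall r : 'I_(size l), h + \sum_(j < size l | (j <= r)%N) l`_j \in [:: 0; 1]] &&
  (h + \sum_(j < size l) l`_j == k).
Proof.
elim: l h => [|e l IHl] h /=.
  by rewrite big_ord0 addr0 (_ : [forall r, _]) //; apply/forallP => -[].
rewrite IHl [in RHS]big_ord_recl /= !addrA andbA; congr (_ && _).
have E (r : 'I_(size l)) : h + \sum_(j < (size l).+1 | (j <= lift ord0 r)%N) (e :: l)`_j
    = h + e + \sum_(j < size l | (j <= r)%N) l`_j.
  by rewrite big_mkcond big_ord_recl /= addrA [in RHS]big_mkcond.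
apply/andP/forallP => [[H1 /forallP H2] r|H].
  case: (unliftP ord0 r) => [i ->|->]; first by rewrite E.
  by rewrite big_mkcond big_ord_recl /= big1 // addr0.
split; last by apply/forallP => i; rewrite -E.
by have := H ord0; rewrite big_mkcond big_ord_recl /= big1 // addr0.
Qed.

Definition prefixes01 n (a : 'I_n -> 'I_n -> int) :=
  [forall i : 'I_n, forall r : 'I_n, \sum_(j < n | (j <= r)%N) a i j \in [:: 0; 1]].

(** The last condition expresses the flip between the end of row [i] and the bottom of column
    [i]. *)
Definition qt_good n (a : 'I_n -> 'I_n -> int) :=
  [&& prefixes01 a, prefixes01 (fun i j => a j i) &
      [forall i : 'I_n, \sum_(j < n) a i j + \sum_(j < n) a j i == 1]].

Lemma prefix01_ord n (f : 'I_n -> int) (l : seq int) k :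
  size l = n -> (forall j : 'I_n, l`_j = f j) ->
  prefix01 0 l k = [forall r : 'I_n, \sum_(j < n | (j <= r)%N) f j \in [:: 0; 1]] &&
    (\sum_(j < n) f j == k).
Proof.
move=> sl; subst n => fl; rewrite prefix01E add0r; congr (_ && _).
  by apply: eq_forallb => r; rewrite add0r (eq_bigr f).
by congr (_ == _); apply: eq_bigr => j _; rewrite fl.
Qed.

Lemma all_zip3 (S T U : Type) (P : pred (S * T * U)) n (s : n.-tuple S)
    (t : n.-tuple T) (u : n.-tuple U) :
  all P (zip (zip s t) u) = [forall i : 'I_n, P (tnth s i, tnth t i, tnth u i)].
Proof.
elim: n s t u => [|n IHn] s t u.
  by rewrite (tuple0 s) (tuple0 t) (tuple0 u) /=; apply/esym/forallP => -[].
case/tupleP: s => x s; case/tupleP: t => y t; case/tupleP: u => z u /=.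
rewrite IHn; apply/andP/forallP => [[H1 /forallP H2] j|H].
  by case: (unliftP ord0 j) => [i ->|->]; rewrite ?tnthS ?tnth0.
split; first by have := H ord0; rewrite !tnth0.
by apply/forallP => i; have := H (lift ord0 i); rewrite !tnthS.
Qed.

Lemma forallb_and (I : finType) (P Q : pred I) :
  [forall i, P i && Q i] = [forall i, P i] && [forall i, Q i].
Proof.
apply/forallP/andP => [H|[/forallP HP /forallP HQ] i]; last by rewrite HP HQ.
by split; apply/forallP => i; case/andP: (H i).
Qed.

Lemma prefixes01_sum n (a : 'I_n -> 'I_n -> int) i :
  prefixes01 a -> \sum_(j < n) a i j \in [:: 0; 1].
Proof.
case: n a i => [a []//|n a i] /forallP/(_ i)/forallP/(_ ord_max).
by rewrite (eq_bigl xpredT) // => j; rewrite -ltnS ltn_ord.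
Qed.

(** The matrix determines the turning states: [h] lists the row sums, and its negation must list the
    column sums. *)
Lemma qtZ1_count n : qtZ1 R n =
  (#|[set M : n.-tuple (n.-tuple asm_entry) |
      qt_good (fun i j => entv (tnth (tnth M i) j))]|)%:R.
Proof.
rewrite /qtZ1 /qtZ size_iota.
transitivity (\sum_(h : n.-tuple bool) \sum_(M : n.-tuple (n.-tuple asm_entry))
   ((rows_ok (falses n) h M &&
     cols_ok [tuple of map negb h] [tuple of nseq n false] M)%:R : R)).
  apply: eq_bigr => h _.
  rewrite (@grid1_count n _ _ _ _ [tuple of map negb h] [tuple of nseq n false]);
    rewrite ?size_iota ?size_nseq ?size_tuple //.
rewrite exchange_big -sum1_card natr_sum [RHS]big_mkcond; apply: eq_bigr => M _.
pose a i j := entv (tnth (tnth M i) j).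
rewrite inE -/a.
have rowE (h : n.-tuple bool) : rows_ok (falses n) h M =
    prefixes01 a && [forall i, \sum_(j < n) a i j == bz (tnth h i)].
  rewrite /rows_ok (all_zip3 _ [tuple of nseq n false]) -forallb_and.
  apply: eq_forallb => i /=; rewrite tnth_nseq -(@prefix01_ord n (a i) (map entv (tnth M i))) //.
    by rewrite size_map size_tuple.
  move=> j; rewrite (nth_map (tnth (tnth M i) j)) ?size_tuple //.
  by rewrite -tnth_nth.
have colE (h : n.-tuple bool) :
    cols_ok [tuple of map negb h] [tuple of nseq n false] M =
    prefixes01 (fun i j => a j i) && [forall j, \sum_(i < n) a i j == bz (~~ tnth h j)].
  rewrite /cols_ok -forallb_and.
  apply: eq_forallb => j; rewrite tnth_nseq tnth_map.
  rewrite -(@prefix01_ord n (fun i => a i j) [seq entv (tnth b j) | b <- M]) //.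
    by rewrite size_map size_tuple.
  move=> i; rewrite (nth_map (tnth M i)) ?size_tuple //.
  by rewrite -tnth_nth.
under eq_bigr do rewrite rowE colE.
rewrite /qt_good.
case pA : (prefixes01 a); last by rewrite big1.
case pB : (prefixes01 _); last by rewrite big1 // => h _; rewrite andbF.
rewrite /=.
have /fin_all_exists[v Ev] i : exists b, \sum_(j < n) a i j = bz b.
  by apply/mem01P; apply: prefixes01_sum pA.
rewrite (bigD1 [tuple v i | i < n]) // big1 => [|h hv]; last first.
  rewrite [X in X && _](_ : _ = false) //.
  apply: contraNF hv => /forallP H; apply/eqP/eq_from_tnth => i.
  by rewrite tnth_mktuple; apply/bz_inj; rewrite -Ev; apply/esym/eqP.
rewrite [LHS]addr0.
have -> /= : [forall i, \sum_(j < n) a i j == bz (tnth [tuple v i | i < n] i)].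
  by apply/forallP => i; rewrite tnth_mktuple Ev.
have -> : [forall j, \sum_(i < n) a i j == bz (~~ tnth [tuple v i | i < n] j)] =
   [forall i, \sum_(j < n) a i j + \sum_(j < n) a j i == 1].
  apply: eq_forallb => i; rewrite tnth_mktuple Ev.
  by case: (v i); apply/eqP/eqP => /=; rewrite /bz /=; lia.
by case: [forall _, _].
Qed.

End Counting.

(** * Admissibility and maximality for a single matrix *)

Lemma sub01 (z : int) : (1 - z \in [:: 0; 1]) = (z \in [:: 0; 1]).
Proof. by rewrite !inE; apply/orP/orP => -[] /eqP E; [right|left|right|left]; apply/eqP; lia. Qed.

Section OneMatrix.
Variables (n : nat) (A : 1.-tuple 'M[asm_entry]_n).

Let a i j := ent A ord0 i j.
Let Rs i := \sum_(j < n) a i j.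
Let Cs i := \sum_(j < n) a j i.

Lemma row_condition1 : row_condition A = prefixes01 a.
Proof.
apply/forallP/idP => [/(_ ord0) //|H l].
by rewrite (ord1 l).
Qed.

(** Summing column [i] from the bottom leaves out its top [n.-1 - r] entries, which are subtracted
    from the full sum. *)
Lemma chain_condition1 : chain_condition A =
  [forall i : 'I_n, forall r : 'I_n,
     Rs i + Cs i - \sum_(j < n | (j < n.-1 - r)%N) a j i \in [:: 0; 1]].
Proof.
have E i (r : 'I_n) : \sum_(j < n) ent A (ord_pred ord0) i j
      + \sum_(j < n | (j <= r)%N) ent A ord0 (rev_ord j) i =
     Rs i + Cs i - \sum_(j < n | (j < n.-1 - r)%N) a j i.
  rewrite (ord1 (ord_pred ord0)) -/(Rs i) -addrA; congr (_ + _).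
  rewrite (reindex_inj rev_ord_inj) /=.
  rewrite [Cs i](bigID (fun j : 'I_n => (j < n.-1 - r)%N)) /= [RHS]addrC addKr.
  apply: eq_big => j; last by rewrite rev_ordK.
  by have := ltn_ord j; have := ltn_ord r; lia.
apply/forallP/forallP => [/(_ ord0)/forallP H i|H l].
  by apply/forallP => r; rewrite -E; exact: (forallP (H i)).
rewrite (ord1 l); apply/forallP => i; apply/forallP => r; rewrite E.
exact: (forallP (H i)).
Qed.

Lemma total_sum1 : (total_sum A) *+ 2 = \sum_(i < n) (Rs i + Cs i).
Proof.
rewrite big_split /= mulr2n /total_sum big_ord_recl big_ord0 addr0; congr (_ + _).
by rewrite exchange_big.
Qed.

Lemma admissible_qt_good : cc_admissible A -> (forall i, Rs i + Cs i = 1) -> qt_good a.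
Proof.
rewrite /cc_admissible row_condition1 chain_condition1 => /andP[rA cA] RC.
apply/and3P; split=> //; last by apply/forallP => i; rewrite -[_ + _]/(Rs i + Cs i) RC.
apply/forallP => i; apply/forallP => r.
(* By [sub01] the chain condition gives the column prefixes of length less than [n]; the full column
   sum is 1 minus a row sum. *)
have [rn|rn] := ltnP r n.-1; last first.
  rewrite (eq_bigl xpredT); last by move=> j; have := ltn_ord j; have := ltn_ord r; lia.
  have RE : 1 - Cs i = Rs i by rewrite -(RC i) addrK.
  by rewrite -/(Cs i) -sub01 RE; apply: prefixes01_sum.
have rn' : (n.-1 - r.+1 < n)%N by lia.
move/forallP/(_ i)/forallP/(_ (Ordinal rn')): cA; rewrite RC sub01 /=.
by rewrite (eq_bigl (fun j : 'I_n => (j <= r)%N)) // => j; lia.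
Qed.

Lemma qt_good_admissible : qt_good a -> cc_admissible A.
Proof.
case/and3P => rA cA /forallP RC; rewrite /cc_admissible row_condition1 rA chain_condition1.
apply/forallP => i; apply/forallP => r; rewrite (eqP (RC i)) sub01.
case E : (n.-1 - r)%N => [|k]; first by rewrite big_pred0.
have kn : (k < n)%N by have := ltn_ord r; lia.
exact: (forallP (forallP cA i) (Ordinal kn)).
Qed.

Lemma qt_good_total m : n = (2 * m)%N -> qt_good a -> total_sum A = m%:Z.
Proof.
move=> nm /and3P[_ _ /forallP RC]; have := total_sum1.
rewrite (eq_bigr (fun=> 1)); last by move=> i _; apply/eqP/(RC i).
by rewrite sumr_const card_ord; move: (total_sum A) => t; rewrite nm; lia.
Qed.

Lemma row_col_sum01 i : cc_admissible A -> Rs i + Cs i \in [:: 0; 1].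
Proof.
rewrite /cc_admissible chain_condition1 => /andP[_ /forallP/(_ i)/forallP cA].
have n0 : (n.-1 < n)%N by have := ltn_ord i; lia.
have := cA (Ordinal n0); rewrite /= subnn big_pred0 ?subr0 //.
Qed.

Lemma admissible_total_le m : n = (2 * m)%N -> cc_admissible A -> total_sum A <= m%:Z.
Proof.
move=> nm adm; have := total_sum1.
have : \sum_(i < n) (Rs i + Cs i) <= \sum_(i < n) 1.
  by apply: ler_sum => i _; have := row_col_sum01 i adm; rewrite !inE => /orP[] /eqP->.
rewrite sumr_const card_ord; move: (total_sum A) (\sum_(i < n) _) => t u; rewrite nm; lia.
Qed.

(** The [2 * m] sums [Rs i + Cs i] are at most 1 and add up to [2 * m], so each of them is 1. *)
Lemma admissible_total_eq m : n = (2 * m)%N -> cc_admissible A ->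
  total_sum A = m%:Z -> qt_good a.
Proof.
move=> nm adm tot; apply: admissible_qt_good => // i.
have D0 : \sum_(i < n) (1 - (Rs i + Cs i)) == 0.
  by rewrite sumrB sumr_const card_ord -total_sum1 tot; apply/eqP; move: nm; lia.
have := D0; rewrite psumr_eq0.
  by move/allP/(_ i); rewrite mem_index_enum subr_eq0 => /(_ isT)/eqP.
by move=> k _; have := row_col_sum01 k adm; rewrite !inE => /orP[] /eqP->.
Qed.

End OneMatrix.

(** The matrix [A0] shows that the upper bound [m] on the total sum is attained. *)
Lemma ASMo_qt_good m (A0 : 1.-tuple 'M[asm_entry]_(2 * m)) : qt_good (ent A0 ord0) ->
  ASMo (2 * m) 1 = [set A | qt_good (ent A ord0)].
Proof.
move=> g0; apply/setP => A; rewrite !inE; apply/andP/idP.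
  move=> [adm /forallP/(_ A0)]; rewrite qt_good_admissible //= (@qt_good_total _ _ m _ g0) // => le.
  apply: (@admissible_total_eq _ _ m) => //.
  by apply/eqP; rewrite eq_le le andbT admissible_total_le.
move=> gA; split; first exact: qt_good_admissible.
apply/forallP => B; apply/implyP => admB; rewrite (@qt_good_total _ _ m _ gA) //.
exact: admissible_total_le.
Qed.

Lemma card_qt_good n :
  #|[set M : n.-tuple (n.-tuple asm_entry) |
      qt_good (fun i j => entv (tnth (tnth M i) j))]| =
  #|[set A : 1.-tuple 'M[asm_entry]_n | qt_good (ent A ord0)]|.
Proof.
pose f (A : 1.-tuple 'M[asm_entry]_n) := [tuple [tuple tnth A ord0 i j | j < n] | i < n].
have fb : bijective f.
  exists (fun M : n.-tuple (n.-tuple asm_entry) =>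
            [tuple of [:: (\matrix_(i, j) tnth (tnth M i) j : 'M[asm_entry]_n)]]).
    move=> A; apply: eq_from_tnth => k; rewrite (ord1 k) tnth0; apply/matrixP => i j.
    by rewrite mxE !tnth_mktuple.
  move=> M; apply: eq_from_tnth => i; rewrite tnth_mktuple.
  by apply: eq_from_tnth => j; rewrite tnth_mktuple tnth0 mxE.
rewrite -(on_card_preimset (f := f)); last exact: (onW_bij _ fb).
apply: eq_card => A; rewrite !inE /qt_good /prefixes01.
have E i j : entv (tnth (tnth (f A) i) j) = ent A ord0 i j.
  by rewrite !tnth_mktuple.
congr [&& _, _ & _].
- apply: eq_forallb => i; apply: eq_forallb => r.
  by rewrite (eq_bigr (fun j => ent A ord0 i j)).
- apply: eq_forallb => i; apply: eq_forallb => r.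
  by rewrite (eq_bigr (fun j => ent A ord0 j i)).
- apply: eq_forallb => i; rewrite (eq_bigr (fun j => ent A ord0 i j)) //.
  by rewrite [X in _ + X](eq_bigr (fun j => ent A ord0 j i)).
Qed.

(** * Conclusion over the algebraic numbers *)

Lemma cube_root : exists2 w : algC, w ^+ 2 = - w - 1 & w != 1.
Proof.
have [w pw] := C_prim_root_exists (isT : (0 < 3)%N); exists w; last first.
  by rewrite -[w]expr1 -(prim_order_dvd pw).
have w1 : w - 1 != 0 by rewrite subr_eq0 -[w]expr1 -(prim_order_dvd pw).
apply/eqP; rewrite -subr_eq0 -(mulrI_eq0 _ (mulfI w1)); apply/eqP.
transitivity (w ^+ 3 - 1); first by ring.
by rewrite (prim_expr_order pw) subrr.
Qed.

Theorem corollary4p14 (m : nat) (hm : (1 <= m)%N) :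
  (#|ASMo (2 * m) 1|)%:R =
    (\prod_(0 <= k < m) ((3 * k + 1)`!%:R / (m + k)`!%:R)) ^+ 3 *
    \prod_(1 <= i < m.+1)
      ((3 * i%:R - 1) / (3 * i%:R - 2) *
       \prod_(i <= j < m.+1)
         ((m%:R + i%:R + j%:R - 1) / (2 * i%:R + j%:R - 1))) :> rat.
Proof.
have [w w2 w1] := cube_root.
have := qtZ1_formula w2 w1 m.
rewrite qtZ1_count card_qt_good.
rewrite -natrM => /eqP; rewrite eqr_nat => /eqP E.
rewrite -/(asmA m) -/(cspp m) -(count_formula E); congr (_%:R).
(* Positivity of the right side of [E] makes the count nonzero, which provides the matrix [A0] that
   [ASMo_qt_good] requires. *)
have : (0 < vdm exp01 (2 * m) ^ 3 * vdm exp02 (2 * m))%N.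
  by rewrite muln_gt0 expn_gt0 (vdm_gt0 _ exp01_homo) (vdm_gt0 _ exp02_homo).
rewrite -E muln_gt0 => /andP[/card_gt0P[A0 + _]].
by rewrite inE => /ASMo_qt_good ->.
Qed.
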